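(* Let $(W,S)$ be a Coxeter system and let $(\mathscr I,J)$ be a $W$-graph ideal. Suppose that $K\subseteq S$ and $d\in D_K^{-1}\cap\mathscr I$. Then $\mathscr I_d=\{v\in W_K\mid vd\in\mathscr I\}$ is a $W_K$-graph ideal with respect to $L=K\cap dJd^{-1}$; that is, $(\mathscr I_d,L)$ is a $W_K$-graph ideal.
   Context: Coxeter groups and Hecke algebras. $(W,S)$ is a Coxeter system with length function $l$; $\leqslant$ is the Bruhat order, and $\leqslant_L$ is the left weak order: $v\leqslant_L w$ iff $l(w)=l(wv^{-1})+l(v)$. An ideal of $(W,\leqslant_L)$ is a nonempty subset $\mathscr I\subseteq W$ such that $v\leqslant_L w\in\mathscr I$ implies $v\in\mathscr I$. For $J\subseteq S$, $W_J$ is the subgroup generated by $J$ and $D_J=\{w\in W\mid l(ws)>l(w)\text{ for all }s\in J\}$; $D_K^{-1}=\{w^{-1}\mid w\in D_K\}$ is the set of minimal representatives of the right cosets $W_Kw$. $\mathcal A=\mathbb Z[q,q^{-1}]$, $\mathcal A^+=\mathbb Z[q]$, and $a\mapsto\overline a$ is the ring automorphism of $\mathcal A$ with $\overline q=q^{-1}$. The Hecke algebra $\mathcal H=\mathcal H(W)$ is the associative $\mathcal A$-algebra generated by $\{T_s\mid s\in S\}$ with relations $T_s^2=1+(q-q^{-1})T_s$ and the braid relations $T_sT_tT_s\cdots=T_tT_sT_t\cdots$ ($m(s,t)$ factors on each side, $m(s,t)$ the order of $st$). It has the $\mathcal A$-semilinear ring involution $h\mapsto\overline h$ with $\overline{T_s}=T_s^{-1}=T_s-(q-q^{-1})$.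 $W$-graph ideals. Let $\mathscr I$ be an ideal of $(W,\leqslant_L)$ and $J\subseteq S$ with $\mathscr I\subseteq D_J$. For $w\in\mathscr I$ put $\mathrm{SD}(w)=\{s\in S\mid sw<w\}$, $\mathrm{SA}(w)=\{s\mid sw>w,\ sw\in\mathscr I\}$, $\mathrm{WD}(w)=\{s\mid sw>w,\ sw\notin D_J\}$, $\mathrm{WA}(w)=\{s\mid sw>w,\ sw\in D_J\setminus\mathscr I\}$. The pair $(\mathscr I,J)$ is a $W$-graph ideal (equivalently, $\mathscr I$ is a $W$-graph ideal with respect to $J$) if there is an $\mathcal H$-module $\mathscr S$ such that: (i) $\mathscr S$ has an $\mathcal A$-basis $\{b_w\mid w\in\mathscr I\}$ with $T_sb_w=b_{sw}$ if $s\in\mathrm{SA}(w)$; $T_sb_w=b_{sw}+(q-q^{-1})b_w$ if $s\in\mathrm{SD}(w)$; $T_sb_w=-q^{-1}b_w$ if $s\in\mathrm{WD}(w)$; $T_sb_w=qb_w-\sum_{y\in\mathscr I,\,y<sw}r^s_{y,w}b_y$ for some $r^s_{y,w}\in q\mathcal A^+$ if $s\in\mathrm{WA}(w)$; and (ii) $\mathscr S$ admits an $\mathcal A$-semilinear involution $\alpha\mapsto\overline\alpha$ with $\overline{b_1}=b_1$ and $\overline{h\alpha}=\overline h\,\overline\alpha$ for all $h\in\mathcal H$, $\alpha\in\mathscr S$. A $W_K$-graph ideal is the same notion for the Coxeter system $(W_K,K)$. *)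

(* Defs.v *)
From HB Require Import structures.
From mathcomp Require Import all_boot all_order all_algebra.
From mathcomp Require Import boolp classical_sets functions cardinality fsbigop.
From mathcomp Require Import ring.

Set Implicit Arguments.
Unset Strict Implicit.
Unset Printing Implicit Defensive.

Import GRing.Theory.
Local Open Scope classical_set_scope.
Local Open Scope ring_scope.
Local Open Scope quotient_scope.

(* Z[q, q^-1], as the subring of Frac(Z[q]) of the fractions p / q^n. *)
Definition laurent_pred : {pred {fraction {poly int}}} :=
  fun x => `[< exists (p : {poly int}) (n : nat),
                 x = FracField.tofrac p / FracField.tofrac 'X ^+ n >].

Lemma fracX_neq0 : FracField.tofrac ('X : {poly int}) != 0.
Proof. by rewrite tofrac_eq0 polyX_eq0. Qed.

Lemma laurent_pred_subring : subring_closed laurent_pred.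
Proof.
have X0 := fracX_neq0.
split.
- by apply/asboolP; exists 1, 0%N; rewrite expr0 divr1 tofrac1.
- move=> x y /asboolP[p [n ->]] /asboolP[r [m ->]]; apply/asboolP.
  exists (p * 'X^m - r * 'X^n), (n + m)%N.
  rewrite rmorphB !rmorphM !rmorphXn /= exprD -!mulNr addf_div ?expf_neq0//.
- move=> x y /asboolP[p [n ->]] /asboolP[r [m ->]]; apply/asboolP.
  by exists (p * r), (n + m)%N; rewrite rmorphM /= exprD -mulf_div.
Qed.

HB.instance Definition _ :=
  GRing.isSubringClosed.Build {fraction {poly int}} laurent_pred
    laurent_pred_subring.

Definition laurent : Type := {x : {fraction {poly int}} | x \in laurent_pred}.

HB.instance Definition _ := [isSub of laurent for (@sval _ _)].
HB.instance Definition _ := [Choice of laurent by <:].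
HB.instance Definition _ := [SubChoice_isSubComNzRing of laurent by <:].

Lemma lq_subproof : FracField.tofrac ('X : {poly int}) \in laurent_pred.
Proof. by apply/asboolP; exists 'X, 0%N; rewrite expr0 divr1. Qed.

Lemma lqV_subproof : (FracField.tofrac ('X : {poly int}))^-1 \in laurent_pred.
Proof. by apply/asboolP; exists 1, 1%N; rewrite expr1 tofrac1 mul1r. Qed.

Definition lq : laurent := @exist _ (fun x => x \in laurent_pred) _ lq_subproof.
Definition lqV : laurent := @exist _ (fun x => x \in laurent_pred) _ lqV_subproof.

Lemma lqK : lq * lqV = 1.
Proof. by apply: val_inj; rewrite /= mulfV ?fracX_neq0. Qed.

Lemma lqVK : lqV * lq = 1. Proof. by rewrite mulrC lqK. Qed.

(* p(a), for an integer polynomial p and a Laurent polynomial a *)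
Definition leval (a : laurent) (p : {poly int}) : laurent :=
  (map_poly (intr : int -> laurent) p).[a].

Lemma levalX a : leval a 'X = a.
Proof. by rewrite /leval map_polyX hornerX. Qed.

Lemma levalD a : {morph leval a : p r / p + r}.
Proof. by move=> p r; rewrite /leval rmorphD hornerD. Qed.

Lemma levalB a : {morph leval a : p r / p - r}.
Proof. by move=> p r; rewrite /leval rmorphB hornerD hornerN. Qed.

Lemma levalM a : {morph leval a : p r / p * r}.
Proof. by move=> p r; rewrite /leval rmorphM hornerM. Qed.

Lemma leval1 a : leval a 1 = 1.
Proof. by rewrite /leval rmorph1 hornerC. Qed.

Lemma levalXn a n : leval a 'X^n = a ^+ n.
Proof. by rewrite /leval map_polyXn hornerXn. Qed.

Lemma leval_lq p : val (leval lq p) = FracField.tofrac p.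
Proof.
elim/poly_ind: p => [|p c IHp]; first by rewrite /leval rmorph0 horner0 tofrac0.
rewrite levalD levalM levalX /= IHp rmorphD rmorphM /=; congr (_ + _).
have -> : c%:P = c%:~R by rewrite -[c in LHS]intz rmorph_int.
rewrite /leval rmorph_int -[in LHS](rmorph_int polyC) hornerC [RHS]rmorph_int.
exact: (rmorph_int (val : laurent -> _)).
Qed.

Lemma laurentP (a : laurent) :
  exists (p : {poly int}) (n : nat), a * lq ^+ n = leval lq p.
Proof.
have /asboolP[p [n e]] := valP a; exists p, n; apply: val_inj.
by rewrite leval_lq rmorphM rmorphXn /= e mulfVK ?expf_neq0 ?fracX_neq0.
Qed.

Lemma leval_lq_inj : injective (leval lq).
Proof.
move=> p r e; apply/eqP; rewrite -tofrac_eq; apply/eqP.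
by rewrite -!leval_lq e.
Qed.

(* The automorphism of Z[q, q^-1] exchanging q and q^-1; [lbarE] shows that the
   representation a = p(q) / q^n chosen here does not matter. *)
Definition lbar (a : laurent) : laurent :=
  let p := projT1 (cid (laurentP a)) in
  let n := projT1 (cid (projT2 (cid (laurentP a)))) in
  leval lqV p * lq ^+ n.

Lemma lbarE a p n : a * lq ^+ n = leval lq p -> lbar a = leval lqV p * lq ^+ n.
Proof.
rewrite /lbar; case: cid => r /= h; case: cid => m /= em en.
have : leval lq (r * 'X^n) = leval lq (p * 'X^m).
  by rewrite !levalM !levalXn -em -en mulrAC.
move=> /leval_lq_inj/(congr1 (leval lqV)); rewrite !levalM !levalXn => e.
have K k : lqV ^+ k * lq ^+ k = 1 by rewrite -exprMn lqVK expr1n.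
transitivity (leval lqV r * lqV ^+ n * lq ^+ n * lq ^+ m).
  by rewrite -[_ * lqV ^+ n * _]mulrA K mulr1.
by rewrite e -[RHS]mulr1 -(K m); ring.
Qed.

Lemma lbar_is_zmod_morphism : zmod_morphism lbar.
Proof.
move=> a b; have [p [n ea]] := laurentP a; have [r [m eb]] := laurentP b.
rewrite (lbarE ea) (lbarE eb).
rewrite (@lbarE _ (p * 'X^m - r * 'X^n) (n + m)).
  rewrite levalB !levalM !levalXn exprD.
  have K k : lqV ^+ k * lq ^+ k = 1 by rewrite -exprMn lqVK expr1n.
  rewrite mulrBl; congr (_ - _).
    by rewrite -[RHS]mulr1 -(K m); ring.
  by rewrite -[RHS]mulr1 -(K n); ring.
by rewrite levalB !levalM !levalXn -ea -eb exprD; ring.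
Qed.

Lemma lbar_is_monoid_morphism : monoid_morphism lbar.
Proof.
split; first by rewrite (@lbarE _ 1 0) ?leval1 ?expr0 ?mulr1.
move=> a b; have [p [n ea]] := laurentP a; have [r [m eb]] := laurentP b.
rewrite (lbarE ea) (lbarE eb) (@lbarE _ (p * r) (n + m)).
  by rewrite levalM exprD; ring.
by rewrite levalM -ea -eb exprD; ring.
Qed.

HB.instance Definition _ :=
  GRing.isZmodMorphism.Build laurent laurent lbar lbar_is_zmod_morphism.
HB.instance Definition _ :=
  GRing.isMonoidMorphism.Build laurent laurent lbar lbar_is_monoid_morphism.

Lemma lbar_q : lbar lq = lqV.
Proof. by rewrite (@lbarE _ 'X 0) ?levalX ?expr0 ?mulr1. Qed.

Lemma lbar_qV : lbar lqV = lq.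
Proof. by rewrite (@lbarE _ 1 1) ?leval1 ?expr1 ?mul1r ?lqVK. Qed.

Lemma lbar_qqV : lbar (lq - lqV) = lqV - lq.
Proof. by rewrite rmorphB /= lbar_q lbar_qV. Qed.

Lemma lbarK : involutive lbar.
Proof.
move=> a; have [p [n ea]] := laurentP a.
have lbar_eval r : lbar (leval lqV r) = leval lq r.
  rewrite /leval -horner_map /= lbar_qV -map_poly_comp; congr (_.[_]).
  by apply: eq_map_poly => c /=; rewrite rmorph_int.
rewrite (lbarE ea) rmorphM rmorphXn /= lbar_q lbar_eval -ea -mulrA -exprMn.
by rewrite lqK expr1n mulr1.
Qed.

(* q A^+, where A^+ = Z[q] *)
Definition qAplus : set laurent := [set lq * leval lq p | p in [set: {poly int}]].

Section Coxeter.
Variable W : groupType.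
Implicit Types (S J K I : set W) (v w x y s t : W) (u : seq W).

Definition subgroup_set (H : set W) : Prop :=
  [/\ H 1%g, (forall x y, H x -> H y -> H (x * y)%g) & forall x, H x -> H x^-1%g].

Definition generated S : set W := smallest subgroup_set S.

Definition has_order w m : Prop :=
  [/\ (0 < m)%N, (w ^+ m)%g = 1%g &
      forall k, (0 < k < m)%N -> (w ^+ k)%g <> 1%g].

Definition word S : set (seq W) := [set u : seq W | forall s, s \in u -> S s].

Definition word_prod u : W := (\prod_(s <- u) s)%g.

(* The congruence generated by the relators (st)^m(s,t), for m(s,t) finite.
   Since s = t is allowed and ss has order 1, this includes ss. *)
Inductive coxeter_equiv S : seq W -> seq W -> Prop :=
| coxeter_equiv_refl u : coxeter_equiv S u u
| coxeter_equiv_sym u1 u2 : coxeter_equiv S u1 u2 -> coxeter_equiv S u2 u1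
| coxeter_equiv_trans u1 u2 u3 :
    coxeter_equiv S u1 u2 -> coxeter_equiv S u2 u3 -> coxeter_equiv S u1 u3
| coxeter_equiv_cat u1 u2 u3 u4 :
    coxeter_equiv S u1 u2 -> coxeter_equiv S (u3 ++ u1 ++ u4) (u3 ++ u2 ++ u4)
| coxeter_equiv_relator s t m : S s -> S t -> has_order (s * t)%g m ->
    coxeter_equiv S (flatten (nseq m [:: s; t])) [::].

(* (W, S) is a Coxeter system: S consists of elements of order 2, generates W,
   and W = < S | (st)^m(s,t) = 1 >. *)
Definition coxeter_system S : Prop :=
  [/\ forall s, S s -> has_order s 2,
      generated S = [set: W] &
      forall u, word S u -> word_prod u = 1%g -> coxeter_equiv S u [::]].

(* The notions below are relative to the Coxeter system (W_S, S), where W_S is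
   the subgroup generated by S; they apply to (W, S) and to (W_K, K) alike. *)

Definition word_length S w : set nat :=
  [set n | exists u, [/\ word S u, word_prod u = w & size u = n]].

Definition cox_length S w : nat :=
  xget 0%N [set n | word_length S w n /\ forall k, word_length S w k -> (n <= k)%N].

Definition reflections S : set W :=
  [set (w * s * w^-1)%g | w in generated S & s in S].

Inductive bruhat_le S : W -> W -> Prop :=
| bruhat_refl x : bruhat_le S x x
| bruhat_step x y t : bruhat_le S x y -> reflections S t ->
    (cox_length S y < cox_length S (t * y)%g)%N -> bruhat_le S x (t * y)%g.

Definition bruhat_lt S x y : Prop := bruhat_le S x y /\ x <> y.

Definition left_weak_le S v w : Prop :=
  cox_length S w = (cox_length S (w * v^-1)%g + cox_length S v)%N.

Definition weak_ideal S I : Prop :=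
  [/\ I `<=` generated S, I !=set0 &
      forall v w, generated S v -> left_weak_le S v w -> I w -> I v].

(* D_J, computed in (W_S, S) *)
Definition min_left_reps S J : set W :=
  [set w | generated S w /\
           forall s, J s -> (cox_length S w < cox_length S (w * s)%g)%N].

Definition min_right_reps S K : set W := [set w^-1%g | w in min_left_reps S K].

Definition SD S w : set W := [set s | S s /\ bruhat_lt S (s * w)%g w].

Definition SA S I w : set W :=
  [set s | [/\ S s, bruhat_lt S w (s * w)%g & I (s * w)%g]].

Definition WD S J w : set W :=
  [set s | [/\ S s, bruhat_lt S w (s * w)%g & ~ min_left_reps S J (s * w)%g]].

Definition WA S I J w : set W :=
  [set s | [/\ S s, bruhat_lt S w (s * w)%g &
               (min_left_reps S J `\` I) (s * w)%g]].

End Coxeter.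

Section Hecke.
Variables (W : groupType) (S : set W).

(* Noncommutative polynomial expressions in the T_s, with coefficients in A *)
Inductive hecke_term : Type :=
| HGen of S
| HScal of laurent
| HAdd of hecke_term & hecke_term
| HMul of hecke_term & hecke_term.

(* The word s t s ... with m letters *)
Definition alternating (s t : S) (m : nat) : seq S :=
  [seq if odd i then t else s | i <- iota 0 m].

Definition hecke_word (u : seq S) : hecke_term :=
  foldr (fun s x => HMul (HGen s) x) (HScal 1) u.

(* The axioms of associative unital A-algebras, the quadratic relations and the
   braid relations *)
Inductive hecke_equiv : hecke_term -> hecke_term -> Prop :=
| he_refl x : hecke_equiv x x
| he_sym x y : hecke_equiv x y -> hecke_equiv y x
| he_trans x y z : hecke_equiv x y -> hecke_equiv y z -> hecke_equiv x z
| he_add x x' y y' : hecke_equiv x x' -> hecke_equiv y y' ->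
    hecke_equiv (HAdd x y) (HAdd x' y')
| he_mul x x' y y' : hecke_equiv x x' -> hecke_equiv y y' ->
    hecke_equiv (HMul x y) (HMul x' y')
| he_addA x y z : hecke_equiv (HAdd x (HAdd y z)) (HAdd (HAdd x y) z)
| he_addC x y : hecke_equiv (HAdd x y) (HAdd y x)
| he_add0 x : hecke_equiv (HAdd (HScal 0) x) x
| he_addN x : hecke_equiv (HAdd (HMul (HScal (-1)) x) x) (HScal 0)
| he_mulA x y z : hecke_equiv (HMul x (HMul y z)) (HMul (HMul x y) z)
| he_mul1l x : hecke_equiv (HMul (HScal 1) x) x
| he_mul1r x : hecke_equiv (HMul x (HScal 1)) x
| he_mulDl x y z : hecke_equiv (HMul (HAdd x y) z) (HAdd (HMul x z) (HMul y z))
| he_mulDr x y z : hecke_equiv (HMul x (HAdd y z)) (HAdd (HMul x y) (HMul x z))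
| he_scalD a b : hecke_equiv (HScal (a + b)) (HAdd (HScal a) (HScal b))
| he_scalM a b : hecke_equiv (HScal (a * b)) (HMul (HScal a) (HScal b))
| he_scalC a x : hecke_equiv (HMul (HScal a) x) (HMul x (HScal a))
| he_quad s : hecke_equiv (HMul (HGen s) (HGen s))
    (HAdd (HScal 1) (HMul (HScal (lq - lqV)) (HGen s)))
| he_braid (s t : S) m : has_order (val s * val t)%g m ->
    hecke_equiv (hecke_word (alternating s t m)) (hecke_word (alternating t s m)).

HB.instance Definition _ := gen_eqMixin hecke_term.
HB.instance Definition _ := gen_choiceMixin hecke_term.

Definition hecke_eqb (x y : hecke_term) : bool := `[< hecke_equiv x y >].

Lemma hecke_eqb_refl : reflexive hecke_eqb.
Proof. by move=> x; apply/asboolP/he_refl. Qed.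

Lemma hecke_eqb_sym : symmetric hecke_eqb.
Proof. by move=> x y; apply/asboolP/asboolP => /he_sym. Qed.

Lemma hecke_eqb_trans : transitive hecke_eqb.
Proof.
by move=> y x z /asboolP xy /asboolP yz; apply/asboolP/(he_trans xy yz).
Qed.

Canonical hecke_eqb_equiv :=
  EquivRel hecke_eqb hecke_eqb_refl hecke_eqb_sym hecke_eqb_trans.

Definition hecke : Type := {eq_quot hecke_eqb}.

HB.instance Definition _ := Choice.on hecke.
HB.instance Definition _ := EqQuotient.on hecke.

Definition hclass (x : hecke_term) : hecke := \pi_hecke x.

Lemma hclassP x y : hclass x = hclass y <-> hecke_equiv x y.
Proof. by split=> [/eqquotP/asboolP//|h]; apply/eqquotP/asboolP. Qed.

Lemma hclassK (h : hecke) : hclass (repr h) = h.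
Proof. exact: reprK. Qed.

Lemma hclass_ind (P : hecke -> Prop) : (forall x, P (hclass x)) -> forall h, P h.
Proof. by move=> Px h; rewrite -(hclassK h). Qed.

Lemma repr_hclass x : hecke_equiv (repr (hclass x)) x.
Proof. by apply/hclassP; rewrite hclassK. Qed.

Definition hecke_add (g h : hecke) : hecke := hclass (HAdd (repr g) (repr h)).
Definition hecke_mul (g h : hecke) : hecke := hclass (HMul (repr g) (repr h)).
Definition hecke_scal (a : laurent) : hecke := hclass (HScal a).

Lemma hclassD x y : hecke_add (hclass x) (hclass y) = hclass (HAdd x y).
Proof. by apply/hclassP; apply: he_add; apply: repr_hclass. Qed.

Lemma hclassM x y : hecke_mul (hclass x) (hclass y) = hclass (HMul x y).
Proof. by apply/hclassP; apply: he_mul; apply: repr_hclass. Qed.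

(* T_s |-> q defines a one-dimensional module, so 1 <> 0 in the Hecke algebra *)
Fixpoint index_rep (x : hecke_term) : laurent :=
  match x with
  | HGen _ => lq
  | HScal a => a
  | HAdd x y => index_rep x + index_rep y
  | HMul x y => index_rep x * index_rep y
  end.

Lemma index_rep_word u : index_rep (hecke_word u) = lq ^+ size u.
Proof. by elim: u => //= s u ->; rewrite exprS. Qed.

Lemma index_rep_equiv x y : hecke_equiv x y -> index_rep x = index_rep y.
Proof.
elim=> //= {x y}; try by move=> *; ring.
- by move=> x y z _ -> _ ->.
- by move=> x x' y y' _ -> _ ->.
- by move=> x x' y y' _ -> _ ->.
- by move=> _; rewrite mulrBl lqVK; ring.
- by move=> s t m _; rewrite !index_rep_word !size_map.
Qed.

Section HeckeRing.

Local Ltac hlift := repeat (elim/hclass_ind => ?);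
  rewrite /hecke_scal ?(hclassD, hclassM); apply/hclassP.

Lemma hecke_addA : associative hecke_add. Proof. hlift; exact: he_addA. Qed.
Lemma hecke_addC : commutative hecke_add. Proof. hlift; exact: he_addC. Qed.
Lemma hecke_add0 : left_id (hecke_scal 0) hecke_add.
Proof. hlift; exact: he_add0. Qed.
Lemma hecke_addN :
  left_inverse (hecke_scal 0) (hecke_mul (hecke_scal (-1))) hecke_add.
Proof. hlift; exact: he_addN. Qed.
Lemma hecke_mulA : associative hecke_mul. Proof. hlift; exact: he_mulA. Qed.
Lemma hecke_mul1 : left_id (hecke_scal 1) hecke_mul.
Proof. hlift; exact: he_mul1l. Qed.
Lemma hecke_mulr1 : right_id (hecke_scal 1) hecke_mul.
Proof. hlift; exact: he_mul1r. Qed.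
Lemma hecke_mulDl : left_distributive hecke_mul hecke_add.
Proof. hlift; exact: he_mulDl. Qed.
Lemma hecke_mulDr : right_distributive hecke_mul hecke_add.
Proof. hlift; exact: he_mulDr. Qed.
Lemma hecke_scalD a b :
  hecke_scal (a + b) = hecke_add (hecke_scal a) (hecke_scal b).
Proof. hlift; exact: he_scalD. Qed.
Lemma hecke_scalM a b :
  hecke_scal (a * b) = hecke_mul (hecke_scal a) (hecke_scal b).
Proof. hlift; exact: he_scalM. Qed.
Lemma hecke_scalC a x : hecke_mul (hecke_scal a) x = hecke_mul x (hecke_scal a).
Proof. by move: x; hlift; exact: he_scalC. Qed.

Lemma hecke_1_neq0 : hecke_scal 1 != hecke_scal 0.
Proof. by apply/eqP => /hclassP/index_rep_equiv/eqP; rewrite oner_eq0. Qed.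

End HeckeRing.

HB.instance Definition _ := GRing.isNzRing.Build hecke
  hecke_addA hecke_addC hecke_add0 hecke_addN hecke_mulA hecke_mul1 hecke_mulr1
  hecke_mulDl hecke_mulDr hecke_1_neq0.

Definition hecke_scale (a : laurent) (h : hecke) : hecke := hecke_scal a * h.

Lemma hecke_scaleA a b h : hecke_scale a (hecke_scale b h) = hecke_scale (a * b) h.
Proof. by rewrite /hecke_scale hecke_scalM mulrA. Qed.

Lemma hecke_scale1 : left_id 1 hecke_scale.
Proof. by move=> h; rewrite /hecke_scale mul1r. Qed.

Lemma hecke_scaleDr : right_distributive hecke_scale +%R.
Proof. by move=> a g h; rewrite /hecke_scale mulrDr. Qed.

Lemma hecke_scaleDl h : {morph hecke_scale^~ h : a b / a + b}.
Proof. by move=> a b; rewrite /hecke_scale hecke_scalD mulrDl. Qed.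

HB.instance Definition _ := GRing.Zmodule_isLmodule.Build laurent hecke
  hecke_scaleA hecke_scale1 hecke_scaleDr hecke_scaleDl.

Lemma hecke_scaleAl (a : laurent) (g h : hecke) : a *: (g * h) = (a *: g) * h.
Proof. exact: mulrA. Qed.

HB.instance Definition _ :=
  GRing.Lmodule_isLalgebra.Build laurent hecke hecke_scaleAl.

Lemma hecke_scaleAr (a : laurent) (g h : hecke) : a *: (g * h) = g * (a *: h).
Proof.
transitivity (hecke_scal a * g * h); first exact: mulrA.
have -> : hecke_scal a * g = g * hecke_scal a by exact: hecke_scalC.
by symmetry; exact: mulrA.
Qed.

HB.instance Definition _ :=
  GRing.Lalgebra_isAlgebra.Build laurent hecke hecke_scaleAr.

Definition heckeT (s : S) : hecke := hclass (HGen s).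

Lemma hecke_scalE a : hecke_scal a = a%:A.
Proof. by rewrite -[LHS]mulr1. Qed.

Lemma T_quad s : heckeT s * heckeT s = 1 + (lq - lqV) *: heckeT s.
Proof.
have -> : heckeT s * heckeT s = hclass (HMul (HGen s) (HGen s)) by exact: hclassM.
rewrite (proj2 (hclassP _ _) (he_quad s)) -hclassD -hclassM.
by [].
Qed.

Lemma T_word (u : seq S) : hclass (hecke_word u) = \prod_(s <- u) heckeT s.
Proof.
by elim: u => [|s u IHu] /=; rewrite ?big_nil// big_cons -IHu -hclassM.
Qed.

Lemma T_braid (s t : S) m : has_order (val s * val t)%g m ->
  \prod_(r <- alternating s t m) heckeT r = \prod_(r <- alternating t s m) heckeT r.
Proof. by move=> /he_braid h; rewrite -!T_word; apply/hclassP. Qed.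

(* The bar involution: the A-semilinear ring involution sending T_s to
   T_s^-1 = T_s - (q - q^-1) *)
Fixpoint hbar_term (x : hecke_term) : hecke :=
  match x with
  | HGen s => heckeT s - (lq - lqV)%:A
  | HScal a => (lbar a)%:A
  | HAdd x y => hbar_term x + hbar_term y
  | HMul x y => hbar_term x * hbar_term y
  end.

Definition hbar (h : hecke) : hecke := hbar_term (repr h).

Definition Tinv (s : S) : hecke := heckeT s - (lq - lqV)%:A.

Lemma T_Tinv s : heckeT s * Tinv s = 1.
Proof. by rewrite mulrBr T_quad -scalerAr mulr1 addrK. Qed.

Lemma Tinv_T s : Tinv s * heckeT s = 1.
Proof. by rewrite mulrBl T_quad -scalerAl mul1r addrK. Qed.

Lemma prod_Tinv_rev (u : seq S) :
  (\prod_(r <- u) Tinv r) * (\prod_(r <- rev u) heckeT r) = 1.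
Proof.
elim: u => [|s u IHu]; first by rewrite !big_nil mulr1.
rewrite big_cons rev_cons -cats1 big_cat /= big_seq1.
by rewrite mulrA -[_ * _ * \prod_(_ <- _) _]mulrA IHu mulr1 Tinv_T.
Qed.

Lemma prod_rev_Tinv (u : seq S) :
  (\prod_(r <- rev u) heckeT r) * (\prod_(r <- u) Tinv r) = 1.
Proof.
elim: u => [|s u IHu]; first by rewrite !big_nil mulr1.
rewrite big_cons rev_cons -cats1 big_cat /= big_seq1.
by rewrite -mulrA [heckeT s * _]mulrA T_Tinv mul1r IHu.
Qed.

Lemma rev_alternating s t m :
  rev (alternating s t m) = if odd m then alternating s t m else alternating t s m.
Proof.
have sz a b : size (alternating a b m) = m by rewrite size_map size_iota.
apply: (@eq_from_nth _ s) => [|i]; first by rewrite size_rev; case: ifP; rewrite !sz.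
rewrite size_rev sz => im.
have nth_alt a b k : (k < m)%N -> nth s (alternating a b m) k = if odd k then b else a.
  by move=> km; rewrite (nth_map 0%N) ?size_iota// nth_iota.
rewrite nth_rev ?sz// nth_alt; last by rewrite ltn_subrL (leq_trans _ im).
by rewrite oddB//=; case: (odd m); rewrite nth_alt//; case: (odd i).
Qed.

Lemma Tinv_braid (s t : S) m : has_order (val s * val t)%g m ->
  \prod_(r <- alternating s t m) Tinv r = \prod_(r <- alternating t s m) Tinv r.
Proof.
move=> /T_braid e.
have {}e : \prod_(r <- rev (alternating s t m)) heckeT r =
           \prod_(r <- rev (alternating t s m)) heckeT r.
  by rewrite !rev_alternating; case: ifP.
have := prod_rev_Tinv (alternating t s m).
rewrite -e => /(congr1 ( *%R (\prod_(r <- alternating s t m) Tinv r))).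
by rewrite mulrA prod_Tinv_rev mul1r mulr1.
Qed.

Lemma hbar_word (u : seq S) : hbar_term (hecke_word u) = \prod_(r <- u) Tinv r.
Proof.
elim: u => [|s u IHu]; rewrite ?big_nil ?big_cons /= ?IHu//.
by rewrite rmorph1 scale1r.
Qed.

Lemma hbar_equiv x y : hecke_equiv x y -> hbar_term x = hbar_term y.
Proof.
elim=> //= {x y}.
- by move=> x y z _ -> _ ->.
- by move=> x x' y y' _ -> _ ->.
- by move=> x x' y y' _ -> _ ->.
- by move=> x y z; rewrite addrA.
- by move=> x y; rewrite addrC.
- by move=> x; rewrite rmorph0 scale0r add0r.
- by move=> x; rewrite rmorphN1 rmorph0 scaleN1r scale0r mulN1r addNr.
- by move=> x y z; rewrite mulrA.
- by move=> x; rewrite rmorph1 scale1r mul1r.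
- by move=> x; rewrite rmorph1 scale1r mulr1.
- by move=> x y z; rewrite mulrDl.
- by move=> x y z; rewrite mulrDr.
- by move=> a b; rewrite rmorphD scalerDl.
- by move=> a b; rewrite rmorphM -scalerAl mul1r scalerA.
- by move=> a x; rewrite -scalerAl -scalerAr mul1r mulr1.
- move=> s; rewrite -/(Tinv s) rmorph1 scale1r lbar_qqV.
  rewrite [X in Tinv s * X]/Tinv mulrBr Tinv_T -scalerAr mulr1.
  by rewrite -scalerAl mul1r -scaleNr opprB.
- by move=> s t m st; rewrite !hbar_word; apply: Tinv_braid.
Qed.

Lemma hbar_hclass x : hbar (hclass x) = hbar_term x.
Proof. exact/hbar_equiv/repr_hclass. Qed.

Lemma hbar_is_zmod_morphism : zmod_morphism hbar.
Proof.
have hD : {morph hbar : g h / g + h}.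
  by elim/hclass_ind => x; elim/hclass_ind => y; rewrite [X in hbar X]hclassD
    !hbar_hclass.
by move=> g h; apply: (addIr (hbar h)); rewrite -hD !subrK.
Qed.

Lemma hbar_is_monoid_morphism : monoid_morphism hbar.
Proof.
split; first by rewrite hbar_hclass /= rmorph1 scale1r.
by elim/hclass_ind => x; elim/hclass_ind => y; rewrite [X in hbar X]hclassM
    !hbar_hclass.
Qed.

HB.instance Definition _ :=
  GRing.isZmodMorphism.Build hecke hecke hbar hbar_is_zmod_morphism.
HB.instance Definition _ :=
  GRing.isMonoidMorphism.Build hecke hecke hbar hbar_is_monoid_morphism.

Lemma hbarZ (a : laurent) (h : hecke) : hbar (a *: h) = lbar a *: hbar h.
Proof.
rewrite -[a *: h]/(hecke_scal a * h) rmorphM /= [hbar (hecke_scal a)]hbar_hclass /=.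
by rewrite -scalerAl mul1r.
Qed.

Lemma hbar_T s : hbar (heckeT s) = heckeT s - (lq - lqV)%:A.
Proof. exact: hbar_hclass. Qed.

Lemma hbarK : involutive hbar.
Proof.
elim/hclass_ind; elim=> [s|a|x IHx y IHy|x IHx y IHy].
- rewrite hbar_T rmorphB /= hbar_T hbarZ rmorph1 lbar_qqV.
  by rewrite -addrA -opprD -scalerDl addrA subrK subrr scale0r subr0.
- by rewrite [hbar (hclass _)]hbar_hclass /= hbarZ rmorph1 lbarK -hecke_scalE.
- rewrite -hclassD -[hecke_add _ _]/(hclass x + hclass y) !rmorphD /=.
  by rewrite IHx IHy.
- rewrite -hclassM -[hecke_mul _ _]/(hclass x * hclass y) !rmorphM /=.
  by rewrite IHx IHy.
Qed.

End Hecke.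

Section WGraphIdeal.
Variables (W : groupType) (S : set W).

(* The Laurent polynomial a acts on an H-module through a%:A = a 1 in H. *)

Definition A_basis (V : lmodType (hecke S)) (I : set W) (b : W -> V) : Prop :=
  (forall v : V, exists (u : seq W) (c : W -> laurent),
     (forall w, w \in u -> I w) /\ v = \sum_(w <- u) (c w)%:A *: b w) /\
  (forall (u : seq W) (c : W -> laurent),
     uniq u -> (forall w, w \in u -> I w) ->
     \sum_(w <- u) (c w)%:A *: b w = 0 -> forall w, w \in u -> c w = 0).

(* The sum over y < sw is a finite-support sum: its index set is finite because
   Bruhat intervals below an element of a Coxeter group are finite. *)
Definition W_graph_ideal (I J : set W) : Prop :=
  [/\ weak_ideal S I, J `<=` S, I `<=` min_left_reps S J &
   exists (V : lmodType (hecke S)) (b : W -> V),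
   [/\ A_basis I b,
       (forall (w : W) (s : S), I w ->
         [/\ SA S I w (val s) -> heckeT s *: b w = b (val s * w)%g,
             SD S w (val s) ->
               heckeT s *: b w = b (val s * w)%g + (lq - lqV)%:A *: b w,
             WD S J w (val s) -> heckeT s *: b w = - (lqV%:A *: b w) &
             WA S I J w (val s) ->
               exists r : W -> laurent,
                 (forall y, I y -> bruhat_lt S y (val s * w)%g -> qAplus (r y)) /\
                 heckeT s *: b w = lq%:A *: b w -
                   \sum_(y \in [set y | I y /\ bruhat_lt S y (val s * w)%g])
                     (r y)%:A *: b y]) &
       exists bar : V -> V,
       [/\ {morph bar : x y / x + y},
           forall (a : laurent) (x : V), bar (a%:A *: x) = (lbar a)%:A *: bar x,
           involutive bar,
           bar (b 1%g) = b 1%g &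
           forall (h : hecke S) (x : V), bar (h *: x) = hbar h *: bar x]]].

End WGraphIdeal.

(* Main.v *)
From HB Require Import structures.
Require Import Defs.
From mathcomp Require Import all_boot all_order all_algebra.
From mathcomp Require Import boolp classical_sets functions cardinality fsbigop.
Set Implicit Arguments.
Unset Strict Implicit.
Unset Printing Implicit Defensive.
Local Open Scope classical_set_scope.

(** Write [W_K] for the subgroup generated by [K].  Every [y] in [W] factors as
    [y = u e] with [u] in [W_K] and [e] of minimal length in the coset [W_K y],
    and [l (u e) = l u + l e].  The map [y |-> e] is monotone for the Bruhat
    order ([bruhat_min_rep]).  Let the given module have basis [b_y], [y] in [I].
    The generator [T_s] maps [b_y] into the span of the [b_z] with [z <= y] or
    [z <= s y] ([hecke_action_span]), so the span [P] of the [b_{u e}] with [e = d]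
    or [l e < l d] is stable under the subalgebra [H (W_K)], and so is the span [N]
    of those with [l e < l d].  The module wanted is the subquotient [P / N]: its
    basis consists of the images of the [b_{v d}], [v] in [I_d].

    The involution descends to [P / N] because [bar b_w] is [b_w] plus a
    combination of the [b_z] with [z < w] ([bar_basis_span]).  In particular
    [bar b_d] is [b_d] modulo [N], since [z < d] forces [z] to lie in another coset
    with a shorter minimal representative; hence the image of [b_d], which is the
    basis vector attached to the identity of [W_K], is fixed.

    The four cases of the action are those of the original module at [w = v d].
    The matching of the cases rests on three comparisons between [W_K] and
    the coset [W_K d]: lengths in [W_K] agree with those in [W] and add up with
    [l d] ([parabolic_length], [min_rep_length]); [u <= v] in [W_K] if and only if
    [u d <= v d] in [W] ([bruhat_lt_mulr]); and [v d] lies in [D_J] if and only if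
    [v] lies in [D_L], for [d] in [D_J] ([min_left_reps_mulr]).  In the last case of
    the action the terms outside [W_K d] vanish modulo [N].

    All facts on Coxeter groups come from one statement, [refl_parity_lt]: the
    number of occurrences of a reflection [t] among the reflections attached to
    a word for [w] has a parity that depends only on [w], and it is odd exactly
    when [l (t w) < l w].  Invariance of this parity is checked on the defining
    relators; the exchange property and its consequences follow. *)

(** * Words and parities of reflections *)

Section Words.
Variable W : groupType.
Local Open Scope group_scope.
Implicit Types (S K : set W) (s t w x y : W) (u v : seq W).

Lemma word_prod_nil : word_prod [::] = 1 :> W.
Proof. by rewrite /word_prod big_nil. Qed.

Lemma word_prod_cons s u : word_prod (s :: u) = s * word_prod u.
Proof. by rewrite /word_prod big_cons. Qed.

Lemma word_prod_cat u v : word_prod (u ++ v) = word_prod u * word_prod v.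
Proof. by rewrite /word_prod big_cat. Qed.

Lemma word_cons K s u : word K (s :: u) <-> K s /\ word K u.
Proof.
split=> [Ku|[Ks Ku] r]; last by rewrite inE => /predU1P[->|/Ku].
by split=> [|r ru]; apply: Ku; rewrite inE ?eqxx ?ru ?orbT.
Qed.

Lemma word_cat K u v : word K u -> word K v -> word K (u ++ v).
Proof. by move=> Ku Kv s; rewrite mem_cat => /orP[/Ku|/Kv]. Qed.

Lemma word_subseq K u v : subseq u v -> word K v -> word K u.
Proof. by move=> /mem_subseq uv Kv s /uv/Kv. Qed.

Lemma word_subset S K u : K `<=` S -> word K u -> word S u.
Proof. by move=> KS Ku s /Ku/KS. Qed.

(** For a reduced word [u], the reflections [t] on which this is true are the
    left inversions of [word_prod u]; for any word it is the parity of the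
    number of prefixes [u1 ++ [:: s]] of [u] with
    [t = word_prod u1 * s * (word_prod u1)^-1]. *)
Fixpoint refl_parity u t : bool :=
  if u is s :: u' then (t == s) (+) refl_parity u' (t ^ s) else false.

Lemma refl_parity_cat u v t :
  refl_parity (u ++ v) t = refl_parity u t (+) refl_parity v (t ^ word_prod u).
Proof.
elim: u t => [|s u IHu] t /=; first by rewrite word_prod_nil conjg1.
by rewrite IHu word_prod_cons conjgM addbA.
Qed.

(** The [2m] reflections attached to the word [stst...st] are
    [(st)^j s], [j < 2m]. *)
Lemma refl_parity_nseq s t m x : s * s = 1 -> t * t = 1 ->
  refl_parity (flatten (nseq m [:: s; t])) x =
  \big[addb/false]_(0 <= j < m.*2) (x == (s * t) ^+ j * s).
Proof.
move=> ss tt; have sV : s^-1 = s by exact: mulg1_eq.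
have tV : t^-1 = t by exact: mulg1_eq.
elim: m x => [|m IHm] x; first by rewrite big_geq.
rewrite doubleS big_nat_recl// big_nat_recl//= IHm expg0 mul1g expg1.
congr (_ (+) (_ (+) _)).
  by rewrite (can2_eq (conjgK s) (conjgKV s)) conjgE invgK sV mulgA.
apply: eq_bigr => j _; rewrite -conjgM.
rewrite (can2_eq (conjgK (s * t)) (conjgKV (s * t))); congr (_ == _).
by rewrite conjgE invgK invgM tV sV expgSr expgS !mulgA.
Qed.

(** When [(st)^m = 1] the two halves of this list coincide, so the relators do
    not change parities. *)
Lemma refl_parity_relator s t m x : s * s = 1 -> t * t = 1 -> (s * t) ^+ m = 1 ->
  refl_parity (flatten (nseq m [:: s; t])) x = false.
Proof.
move=> ss tt stm; rewrite refl_parity_nseq// -addnn (big_cat_nat _ (leq_addr m m))//=.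
rewrite -{2}[m]add0n big_addn addnK.
under [X in _ (+) X]eq_bigr do rewrite expgnDr stm mulg1.
exact: addbb.
Qed.

Lemma coxeter_equiv_parity S u v : (forall s, S s -> s * s = 1) ->
  coxeter_equiv S u v ->
  word_prod u = word_prod v /\ refl_parity u =1 refl_parity v.
Proof.
move=> S2; elim=> {u v} [u|u v _ [e h]|u v w _ [e h] _ [e' h']
  |u v r1 r2 _ [e h]|s t m Ss St [_ stm _]].
- by [].
- by split=> // t; rewrite h.
- by rewrite e e'; split=> // t; rewrite h.
- rewrite !word_prod_cat e; split=> // t.
  by rewrite !refl_parity_cat h e.
split=> [|x]; last by rewrite refl_parity_relator//; exact: S2.
rewrite word_prod_nil -stm {stm}; elim: m => [|m IHm]; first exact: word_prod_nil.
by rewrite /= !word_prod_cons IHm expgS mulgA.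
Qed.

(** The prefix of [u] at which the inversion [t] shows up is followed by the
    letter to omit. *)
Lemma refl_parity_exchange u t : refl_parity u t -> exists v,
  [/\ subseq v u, size u = (size v).+1 & word_prod v = t^-1 * word_prod u].
Proof.
elim: u t => [//|s u IHu] t /=; have [/IHu[v [vu su vE]] _|_] := boolP (refl_parity u (t ^ s)).
  exists (s :: v); rewrite /= eqxx vu su !word_prod_cons vE; split=> //.
  by rewrite -conjVg conjgE !mulgA mulgV mul1g.
rewrite addbF => /eqP->; exists u; split=> //; first exact: subseq_cons.
by rewrite word_prod_cons mulKg.
Qed.

(** * Generated subgroups, reflections and lengths *)

Lemma subgroup_generated K : subgroup_set (generated K).
Proof.
split=> [H [[]//]|x y Kx Ky H hH|x Kx H hH].
  by case: (hH) => -[_ HM _] KH; apply: HM; [exact: Kx|exact: Ky].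
by case: (hH) => -[_ _ HV] KH; apply: HV; exact: Kx.
Qed.

Lemma generated1 K : generated K 1.
Proof. by case: (subgroup_generated K). Qed.

Lemma generatedM K x y : generated K x -> generated K y -> generated K (x * y).
Proof. by case: (subgroup_generated K) => _ KM _; exact: KM. Qed.

Lemma generatedV K x : generated K x -> generated K x^-1.
Proof. by case: (subgroup_generated K) => _ _; exact. Qed.

Lemma mem_generated K s : K s -> generated K s.
Proof. by move=> Ks H [_]; exact. Qed.

Lemma generated_word K u : word K u -> generated K (word_prod u).
Proof.
elim: u => [_|s u IHu /word_cons[Ks /IHu]]; first by rewrite word_prod_nil; exact: generated1.
by rewrite word_prod_cons; apply: generatedM; exact: mem_generated.
Qed.

Lemma generated_subset K S : K `<=` S -> generated K `<=` generated S.
Proof. by move=> KS x Kx H [hH SH]; apply: Kx; split=> // s /KS/SH. Qed.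

Lemma reflections_subset K S : K `<=` S -> reflections K `<=` reflections S.
Proof.
by move=> KS _ [x Kx [s Ks <-]]; exists x; [exact: generated_subset Kx|exists s => //; exact: KS].
Qed.

Lemma reflections_simple K s : K s -> reflections K s.
Proof.
by exists 1; [exact: generated1|exists s => //; rewrite mul1g invg1 mulg1].
Qed.

Lemma reflections_gen K t : reflections K t -> generated K t.
Proof.
move=> [x Kx [s Ks <-]]; apply: generatedM; last exact: generatedV.
by apply: generatedM => //; exact: mem_generated.
Qed.

Lemma reflectionsJ K t x : generated K x -> reflections K t -> reflections K (t ^ x).
Proof.
move=> Kx [y Ky [s Ks <-]]; exists (x^-1 * y).
  by apply: generatedM => //; exact: generatedV.
by exists s => //; rewrite conjgE invgM invgK !mulgA.
Qed.

End Words.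

Section Length.
Variables (W : groupType) (K : set W).
Hypothesis K2 : forall s, K s -> (s * s = 1)%g.
Local Open Scope group_scope.
Implicit Types (s t w x y : W) (u v : seq W).

Let KV s : K s -> s^-1 = s.
Proof. by move/K2/mulg1_eq. Qed.

Lemma word_prod_rev u : word K u -> word_prod (rev u) = (word_prod u)^-1.
Proof.
elim: u => [_|s u IHu /word_cons[Ks /IHu e]]; first by rewrite word_prod_nil invg1.
by rewrite rev_cons -cats1 word_prod_cat !word_prod_cons e word_prod_nil invgM (KV Ks) mulg1.
Qed.

Lemma word_rev u : word K u -> word K (rev u).
Proof. by move=> Ku s; rewrite mem_rev => /Ku. Qed.

Lemma generatedP w : generated K w <-> exists2 u, word K u & word_prod u = w.
Proof.
split=> [|[u Ku <-]]; last exact: generated_word.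
move=> /(_ [set w | exists2 u, word K u & word_prod u = w]); apply.
split; last by move=> s Ks; exists [:: s];
  [move=> r; rewrite inE => /eqP->|rewrite word_prod_cons word_prod_nil mulg1].
split=> [|_ _ [u Ku <-] [v Kv <-]|_ [u Ku <-]].
- by exists [::]; rewrite ?word_prod_nil.
- by exists (u ++ v); rewrite ?word_prod_cat//; exact: word_cat.
- by exists (rev u); rewrite ?word_prod_rev//; exact: word_rev.
Qed.

Let min_length w : generated K w ->
  word_length K w (cox_length K w) /\
  forall k, word_length K w k -> (cox_length K w <= k)%N.
Proof.
move=> /generatedP[u Ku uw].
have ex : exists n, `[< word_length K w n >] by exists (size u); apply/asboolP; exists u.
rewrite /cox_length; case: xgetP => [n _ //|/(_ (ex_minn ex))]; case.
by case: ex_minnP => m /asboolP Km mm; split=> // k Kk; apply: mm; apply/asboolP.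
Qed.

Lemma reduced_word w : generated K w ->
  exists u, [/\ word K u, word_prod u = w & size u = cox_length K w].
Proof. by move=> /min_length[]. Qed.

Lemma length_word u : word K u -> (cox_length K (word_prod u) <= size u)%N.
Proof.
move=> Ku; have [_] := min_length (generated_word Ku); apply.
by exists u.
Qed.

Lemma length1 : cox_length K 1 = 0%N.
Proof.
have /length_word : word K [::] by [].
by rewrite word_prod_nil leqn0 => /eqP.
Qed.

Lemma lengthM x y : generated K x -> generated K y ->
  (cox_length K (x * y) <= cox_length K x + cox_length K y)%N.
Proof.
move=> /reduced_word[u [Ku <- <-]] /reduced_word[v [Kv <- <-]].
by rewrite -word_prod_cat -size_cat; apply: length_word; exact: word_cat.
Qed.

Lemma lengthV x : generated K x -> cox_length K x^-1 = cox_length K x.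
Proof.
have le y : generated K y -> (cox_length K y^-1 <= cox_length K y)%N.
  move=> /reduced_word[u [Ku <- <-]].
  by rewrite -word_prod_rev// -size_rev; apply: length_word; exact: word_rev.
move=> Kx; apply/eqP; rewrite eqn_leq le//= -{1}[x]invgK le//.
exact: generatedV.
Qed.

Lemma length_gen s : K s -> (cox_length K s <= 1)%N.
Proof.
move=> Ks; have /length_word : word K [:: s] by apply/word_cons.
by rewrite word_prod_cons word_prod_nil mulg1.
Qed.

Lemma length_eq0 w : generated K w -> cox_length K w = 0%N -> w = 1.
Proof. by move=> /reduced_word[u [_ <- <-]] /size0nil->; exact: word_prod_nil. Qed.

End Length.

(** * The exchange property *)

Section CoxeterSystem.
Variables (W : groupType) (S : set W).
Hypothesis cox : coxeter_system S.
Local Open Scope group_scope.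
Implicit Types (K J : set W) (s t w x y z d e : W) (u v : seq W).

Local Notation l := (cox_length S).

Lemma coxeter_order2 s : S s -> s * s = 1.
Proof. by case: cox => o2 _ _ /o2[_ + _]; rewrite expg2. Qed.
Local Notation S2 := coxeter_order2.

Lemma coxeter_neq1 s : S s -> s <> 1.
Proof. by case: cox => o2 _ _ /o2[_ _ /(_ 1%N)]; rewrite expg1; exact. Qed.

Lemma coxeter_gen w : generated S w.
Proof. by case: cox => _ -> _. Qed.
Local Notation Sg := coxeter_gen.

Lemma coxeter_simpleV s : S s -> s^-1 = s.
Proof. by move=> /S2/mulg1_eq. Qed.

Lemma coxeter_simpleK s x : S s -> s * (s * x) = x.
Proof. by move=> /S2 ss; rewrite mulgA ss mul1g. Qed.

Lemma reflection2 t : reflections S t -> t * t = 1.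
Proof.
move=> [x _ [s /S2 ss <-]].
by rewrite !mulgA mulgVK -[_ * s * s]mulgA ss mulg1 mulgV.
Qed.

Lemma reflectionV t : reflections S t -> t^-1 = t.
Proof. by move=> /reflection2/mulg1_eq. Qed.

Lemma reflectionK t x : reflections S t -> t * (t * x) = x.
Proof. by move=> /reflection2 tt; rewrite mulgA tt mul1g. Qed.

Let relations u : word S u -> word_prod u = 1 -> forall t, refl_parity u t = false.
Proof.
by case: cox => _ _ rel Su u1 t; case: (coxeter_equiv_parity S2 (rel _ Su u1)) => _ ->.
Qed.

Lemma refl_parity_rev u t : word S u ->
  refl_parity (rev u) (t ^ word_prod u) = refl_parity u t.
Proof.
move=> Su; have := relations (word_cat Su (word_rev Su)) _ t.
rewrite word_prod_cat (word_prod_rev S2 Su) mulgV refl_parity_cat => /(_ erefl).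
by case: refl_parity; case: refl_parity.
Qed.

Lemma refl_parity_word u v : word S u -> word S v ->
  word_prod u = word_prod v -> refl_parity u =1 refl_parity v.
Proof.
move=> Su Sv uv t; have := relations (word_cat Su (word_rev Sv)) _ t.
rewrite word_prod_cat (word_prod_rev S2 Sv) uv mulgV refl_parity_cat => /(_ erefl).
by rewrite uv refl_parity_rev//; case: refl_parity; case: refl_parity.
Qed.

(** For [t = x s x^-1] take the word of [x], then [s], then the reversed word of
    [x]: the two outer parts contribute equally and the letter [s] once. *)
Lemma refl_parity_self u t : reflections S t -> word S u -> word_prod u = t ->
  refl_parity u t.
Proof.
move=> [x Sx [s Ss <-]] Su; have [v [Sv <- _]] := reduced_word S2 Sx => uE.
have Ssv : word S (v ++ s :: rev v).
  by apply: word_cat => //; apply/word_cons; split => //; exact: word_rev.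
rewrite (refl_parity_word Su Ssv); last first.
  by rewrite uE word_prod_cat word_prod_cons (word_prod_rev S2 Sv) mulgA.
set r := _ * _; have rv : r ^ word_prod v = s.
  by rewrite /r conjgE mulgVK mulKg.
rewrite refl_parity_cat /= rv eqxx [s ^ s]conjgE mulKg -rv refl_parity_rev//.
by case: refl_parity.
Qed.

(** The left inversions of [w] are the reflections of odd parity in any word
    for [w].  Odd parity gives a shorter word by the exchange property; for
    even parity the same argument applies to [t * w], because [t] itself has
    odd parity. *)
Lemma refl_parity_lt u t : word S u -> reflections S t ->
  refl_parity u t = (l (t * word_prod u) < l (word_prod u))%N.
Proof.
move=> Su St.
have lt w v : word S v -> word_prod v = w -> refl_parity v t -> (l (t * w) < l w)%N.
  move=> Sv vw; have [r [Sr rw rl]] := reduced_word S2 (Sg w).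
  rewrite (refl_parity_word Sv Sr) ?rw// => /refl_parity_exchange[r' [rr' sr r'E]].
  rewrite -rl sr ltnS -{1}rw -(reflectionV St) -r'E.
  by apply: (length_word S2); exact: (word_subseq rr').
have [/(lt _ _ Su erefl)->//|odd] := boolP (refl_parity u t).
apply/esym/negbTE; rewrite -leqNgt ltnW//.
have [v [Sv vt _]] := reduced_word S2 (Sg t).
have := lt (t * word_prod u) (v ++ u).
rewrite reflectionK//; apply; first exact: word_cat.
  by rewrite word_prod_cat vt.
rewrite refl_parity_cat vt conjgE mulKg (negbTE odd) addbF.
exact: refl_parity_self.
Qed.

(** Parities at [x] and at [t * x] differ, so exactly one of the two is the
    longer. *)
Lemma refl_lt t x : reflections S t -> (l x < l (t * x))%N = ~~ (l (t * x) < l x)%N.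
Proof.
move=> St; have [u [Su <- _]] := reduced_word S2 (Sg x).
have [v [Sv vt _]] := reduced_word S2 (Sg t).
rewrite -refl_parity_lt// -{1}[word_prod u](reflectionK _ St) -vt -word_prod_cat.
rewrite {1}vt -refl_parity_lt//; last exact: word_cat.
rewrite refl_parity_cat (refl_parity_self St Sv vt) vt conjgE mulKg.
by [].
Qed.

Lemma length_simple_lt s x : S s -> (l x < l (s * x))%N -> l (s * x) = (l x).+1.
Proof.
move=> Ss lt; apply/eqP; rewrite eqn_leq lt andbT.
apply: leq_trans (lengthM S2 (Sg s) (Sg x)) _.
by rewrite -add1n leq_add2r (length_gen S2 Ss).
Qed.

Lemma length_simple s : S s -> l s = 1%N.
Proof.
move=> Ss; apply/eqP; rewrite eqn_leq (length_gen S2 Ss) lt0n.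
by apply/eqP => /(length_eq0 S2 (Sg s)); exact: coxeter_neq1.
Qed.

Lemma left_descent w : w <> 1 -> exists2 s, S s & (l (s * w) < l w)%N.
Proof.
have [[|s u] [Su <- ul]] := reduced_word S2 (Sg w); first by rewrite word_prod_nil.
move: Su => /word_cons[Ss Su] _; exists s => //.
by rewrite -ul {1}word_prod_cons coxeter_simpleK// ltnS (length_word S2 Su).
Qed.

(** The word is reduced from its end: a letter that lengthens is kept, and one
    that shortens cancels by exchange against a later letter.  As letters are only
    omitted, a word in [K] stays one, so that a parabolic subgroup inherits the
    length function. *)
Lemma deletion u : word S u -> exists v,
  [/\ subseq v u, word_prod v = word_prod u & size v = l (word_prod u)].
Proof.
elim: u => [|s u IHu]; first by exists [::]; rewrite word_prod_nil (length1 S2).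
move=> /word_cons[Ss Su]; have [v [vu vE sv]] := IHu Su.
have Sv := word_subseq vu Su.
have := refl_lt (word_prod u) (reflections_simple Ss).
have [lt _|_ lt] := boolP (l (s * word_prod u) < l (word_prod u))%N.
  have : refl_parity v s by rewrite refl_parity_lt ?vE//; exact: reflections_simple.
  move=> /refl_parity_exchange[r [rv sr rE]]; exists r.
  rewrite word_prod_cons rE coxeter_simpleV// vE; split=> //.
    exact: subseq_trans (subseq_trans rv vu) (subseq_cons _ _).
  apply/succn_inj; rewrite -sr sv -{1}[word_prod u](coxeter_simpleK _ Ss).
  by apply: length_simple_lt => //; rewrite coxeter_simpleK.
exists (s :: v); rewrite /= eqxx !word_prod_cons vE; split=> //.
by rewrite sv length_simple_lt.
Qed.

Lemma parabolic_reduced K w : K `<=` S -> generated K w -> exists u,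
  [/\ word K u, word_prod u = w & size u = l w].
Proof.
move=> KS /(generatedP (fun s Ks => S2 (KS s Ks)))[u Ku <-].
have [v [vu vE sv]] := deletion (word_subset KS Ku).
by exists v; split=> //; exact: word_subseq Ku.
Qed.

Lemma parabolic_length K w : K `<=` S -> generated K w -> cox_length K w = l w.
Proof.
move=> KS Kw; have K2 s Ks := S2 (KS s Ks).
apply/eqP; rewrite eqn_leq; apply/andP; split.
  have [u [Ku <- <-]] := parabolic_reduced KS Kw.
  exact: length_word.
have [u [Ku <- <-]] := reduced_word K2 Kw.
by apply: (length_word S2); exact: word_subset Ku.
Qed.

(** * Minimal coset representatives *)

Section Parabolic.
Variable K : set W.
Hypothesis KS : K `<=` S.

Lemma parabolic_ind (P : W -> Prop) : P 1 ->
  (forall s (v : W), K s -> generated K v -> (l v < l (s * v))%N -> P v -> P (s * v)) ->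
  forall v : W, generated K v -> P v.
Proof.
move=> P1 Ps v /(parabolic_reduced KS)[u [Ku <- ul]].
elim: u Ku ul => [|s u IHu]; first by rewrite word_prod_nil.
move=> /word_cons[Ks Ku]; rewrite word_prod_cons => ul.
have uE : size u = l (word_prod u).
  apply/eqP; rewrite eqn_leq (length_word S2 (word_subset KS Ku)) andbT.
  rewrite -ltnS -[(size u).+1]/(size (s :: u)) ul (leq_trans (lengthM S2 (Sg _) (Sg _)))//.
  by rewrite -add1n leq_add2r (length_gen S2 (KS Ks)).
apply: Ps => //; [exact: generated_word| |exact: IHu].
by rewrite -uE -ul.
Qed.

Lemma min_right_repsP d :
  min_right_reps S K d <-> forall s, K s -> (l d < l (s * d))%N.
Proof.
split=> [[e [_ De] <-] s Ks|De].
  rewrite -(lengthV S2 (Sg (_ * _))) invgM invgK (coxeter_simpleV (KS Ks)).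
  by rewrite (lengthV S2 (Sg e)) De.
exists d^-1; last exact: invgK.
split=> [|s Ks]; first exact: (Sg d^-1).
rewrite (lengthV S2 (Sg d)) -(lengthV S2 (Sg (_ * _))) invgM invgK.
by rewrite (coxeter_simpleV (KS Ks)) De.
Qed.

(** If a simple reflection [s] in [K] shortened [v * e] but not [v], then
    exchange would remove a letter from [e], and so produce a shorter element of
    the coset [W_K e]. *)
Let shortest_length e (v : W) : (forall w, generated K w -> (l e <= l (w * e))%N) ->
  generated K v -> l (v * e) = (l v + l e)%N.
Proof.
move=> mine; move: v; apply: parabolic_ind => [|s v Ks Kv lt IHv].
  by rewrite mul1g (length1 S2).
rewrite (length_simple_lt (KS Ks) lt) -mulgA addSn -IHv.
apply: (length_simple_lt (KS Ks)).
have Ss := reflections_simple (KS Ks).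
rewrite refl_lt//; apply/negP.
have [r [Sr rv _]] := reduced_word S2 (Sg v).
have [r' [Sr' re _]] := reduced_word S2 (Sg e).
rewrite -rv -re -word_prod_cat -refl_parity_lt//; last exact: word_cat.
rewrite refl_parity_cat !refl_parity_lt//; last first.
  by apply: reflectionsJ => //; exact: Sg.
rewrite rv re [X in X (+) _]ltnNge ltnW// addFb ltnNge mine//.
rewrite conjgE; apply: generatedM; first exact: generatedV.
by apply: generatedM => //; exact: mem_generated.
Qed.

Let exists_shortest x : exists (v e : W), [/\ generated K v, x = v * e &
  forall w, generated K w -> (l e <= l (w * e))%N].
Proof.
have ex : exists n, `[< exists2 v, generated K v & l (v * x) = n >].
  by exists (l (1 * x)); apply/asboolP; exists 1 => //; exact: generated1.
case: (ex_minnP ex) => _ /asboolP[v Kv <-] minv.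
exists v^-1, (v * x); rewrite mulKg; split=> //; first exact: generatedV.
move=> w Kw; apply: minv; apply/asboolP; exists (w * v); last by rewrite mulgA.
exact: generatedM.
Qed.

Lemma parabolic_descent (v : W) : generated K v -> v <> 1 ->
  exists2 s, K s & (l (s * v) < l v)%N.
Proof.
move=> /(parabolic_reduced KS)[[|s u] [+ <- <-]]; first by rewrite word_prod_nil.
move=> /word_cons[Ks Ku] _; exists s => //.
rewrite word_prod_cons coxeter_simpleK ?ltnS; last exact: KS.
exact: (length_word S2 (word_subset KS Ku)).
Qed.

(** The local condition that no [s] in [K] shortens [d] implies that [d] is
    shortest in its coset: otherwise a descent of the [W_K]-factor of [d] would
    shorten [d]. *)
Lemma min_rep_length d (v : W) : min_right_reps S K d -> generated K v ->
  l (v * d) = (l v + l d)%N.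
Proof.
move=> /min_right_repsP De; apply: shortest_length => w Kw.
have [u [e [Ku dE mine]]] := exists_shortest d.
have [u1|u1] := pselect (u = 1).
  by move: dE; rewrite u1 mul1g => ->; exact: mine.
have [s Ks] := parabolic_descent Ku u1.
have := De s Ks; rewrite dE mulgA !(shortest_length mine)//; last first.
  by apply: generatedM => //; exact: mem_generated.
by rewrite ltn_add2r => lt lt'; move: (ltn_trans lt lt'); rewrite ltnn.
Qed.

Lemma exists_min_rep x : exists v e : W,
  [/\ generated K v, min_right_reps S K e & x = v * e].
Proof.
have [v [e [Kv xE mine]]] := exists_shortest x; exists v, e; split=> //.
apply/min_right_repsP => s Ks; rewrite (shortest_length mine (mem_generated Ks)).
by rewrite (length_simple (KS Ks)).
Qed.

(** Exchange in a reduced word for [d] followed by the letter [i]: the letter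
    that [k] removes cannot lie in [d], so it is [i]. *)
Lemma min_rep_mulr d i : min_right_reps S K d -> S i ->
  ~ min_right_reps S K (d * i) -> exists2 k, K k & d * i = k * d.
Proof.
move=> /min_right_repsP De Si ndi.
have [k Kk] : exists2 k, K k & ~ (l (d * i) < l (k * (d * i)))%N.
  apply: contrapT => nk; apply/ndi/min_right_repsP => k Kk.
  by apply: contrapT => lt; apply: nk; exists k.
have Sk := reflections_simple (KS Kk).
rewrite refl_lt// => /negP; rewrite negbK => lt; exists k => //.
have [u [Su ud _]] := reduced_word S2 (Sg d).
have Sui : word S (u ++ [:: i]) by apply: word_cat => //; apply/word_cons.
have := refl_parity_lt Sui Sk.
rewrite word_prod_cat word_prod_cons word_prod_nil mulg1 ud lt refl_parity_cat.
rewrite refl_parity_lt// ud /= ltnNge ltnW ?De//= addbF => /eqP <-.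
by rewrite conjgE mulVKg.
Qed.

(** For [i] in [J], either [d * i] is again a minimal representative, and then
    right multiplication by [i] lengthens [v * d], or [d * i = k * d] with [k] in
    both [K] and [d J d^-1], and then it acts as right multiplication of [v] by
    [k]. *)
Lemma min_left_reps_mulr (J : set W) d (v : W) : J `<=` S ->
  min_right_reps S K d -> min_left_reps S J d -> generated K v ->
  min_left_reps S J (v * d) <->
  min_left_reps K (K `&` [set d * j * d^-1 | j in J]) v.
Proof.
move=> JS Dd [_ Jd] Kv; split=> [[_ Jvd]|[_ Lv]].
  split=> // k [Kk [j Jj kE]]; have kd : k * d = d * j by rewrite -kE mulgVK.
  have Kvk : generated K (v * k) by apply: generatedM => //; exact: mem_generated.
  have := Jvd j Jj; rewrite !parabolic_length// -mulgA -kd mulgA.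
  by rewrite (min_rep_length Dd Kv) (min_rep_length Dd Kvk) ltn_add2r.
split=> [|j Jj]; first exact: (Sg (v * d)).
have [Ddj|] := pselect (min_right_reps S K (d * j)).
  by rewrite -mulgA (min_rep_length Dd Kv) (min_rep_length Ddj Kv) ltn_add2l Jd.
move=> /(min_rep_mulr Dd (JS _ Jj))[k Kk djE].
have Kvk : generated K (v * k) by apply: generatedM => //; exact: mem_generated.
have := Lv k; rewrite !parabolic_length// -mulgA djE mulgA.
rewrite (min_rep_length Dd Kv) (min_rep_length Dd Kvk) ltn_add2r.
by apply; split=> //; exists j => //; rewrite djE mulgK.
Qed.

End Parabolic.
(** * The Bruhat order *)

Section Bruhat.
Variable K : set W.
Hypothesis KS : K `<=` S.

(** An induction principle that uses the length function of the whole group and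
    records that the chain stays in [W_K]. *)
Lemma bruhat_ind x (P : W -> Prop) : generated K x -> P x ->
  (forall y t, generated K y -> reflections K t -> (l y < l (t * y))%N ->
     bruhat_le K x y -> P y -> P (t * y)) ->
  forall y, bruhat_le K x y -> P y.
Proof.
move=> + + + y xy; elim: {y} xy P => [{}x P //|{}x y t xy IHxy Kt lt P Kx Px Pt].
have Ky : generated K y.
  apply: IHxy => // z r Kz Kr _ _ _.
  by apply: generatedM => //; exact: reflections_gen.
apply: (Pt) => //; last exact: IHxy.
move: lt; rewrite !parabolic_length//.
by apply: generatedM => //; exact: reflections_gen.
Qed.

Lemma bruhat_mul x y t : generated K y -> reflections K t -> (l y < l (t * y))%N ->
  bruhat_le K x y -> bruhat_le K x (t * y).
Proof.
move=> Ky Kt lt xy; apply: bruhat_step => //; rewrite !parabolic_length//.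
by apply: generatedM => //; exact: reflections_gen.
Qed.

Lemma bruhat_trans x y z : bruhat_le K x y -> bruhat_le K y z -> bruhat_le K x z.
Proof.
by move=> xy yz; elim: yz xy => // {}y {}z t yz IH Kt lt xy; apply: bruhat_step => //; exact: IH.
Qed.

Lemma bruhat_length x y : generated K x -> bruhat_le K x y -> x = y \/ (l x < l y)%N.
Proof.
move=> Kx; move: y; apply: bruhat_ind => //; first by left.
by move=> y t Ky Kt lt _ [->|lxy]; right=> //; exact: ltn_trans lt.
Qed.

Lemma bruhat_lt_length x y : generated K x -> bruhat_lt K x y -> (l x < l y)%N.
Proof. by move=> Kx [/(bruhat_length Kx)[|]]. Qed.

Lemma bruhat_lt_simple s x : K s -> generated K x ->
  bruhat_lt K x (s * x) <-> (l x < l (s * x))%N.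
Proof.
move=> Ks Kx; split=> [/(bruhat_lt_length Kx)//|lt]; split.
  by apply: bruhat_mul => //; [exact: reflections_simple|exact: bruhat_refl].
by move=> e; move: lt; rewrite -e ltnn.
Qed.

Lemma bruhat_simple_lt s x : K s -> generated K x ->
  bruhat_lt K (s * x) x <-> (l (s * x) < l x)%N.
Proof.
move=> Ks Kx; rewrite -{2 4}[x](coxeter_simpleK _ (KS Ks)).
apply: bruhat_lt_simple => //.
by apply: generatedM => //; exact: mem_generated.
Qed.

(** The reflections attached to a word [s :: u] are [s] and the conjugates by [s]
    of those attached to [u].  So, for [t] other than [s], an inversion [t] of
    [t * y] yields the inversion [t ^ s] of [s * (t * y)]. *)
Lemma refl_lt_mull s t y : S s -> reflections S t -> t <> s ->
  (l y < l (t * y))%N -> (l (s * y) < l (t ^ s * (s * y)))%N.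
Proof.
move=> Ss St ts lt; have Sts := reflectionsJ (Sg s) St.
have tsE : t ^ s * (s * y) = s * (t * y).
  by rewrite conjgE coxeter_simpleV// -!mulgA coxeter_simpleK.
have [u [Su uE _]] := reduced_word S2 (Sg (t * y)).
have Ssu : word S (s :: u) by apply/word_cons.
have := refl_parity_lt Ssu Sts; rewrite word_prod_cons uE /= -tsE reflectionK//.
rewrite -conjgM S2// conjg1 refl_parity_lt// uE reflectionK// lt => <-.
rewrite addbT; apply/eqP => e; apply: ts.
by rewrite -(conjgK s t) e conjgE invgK mulgV mulg1.
Qed.

(** The lifting property, in a form without length hypotheses.  Extend a chain
    of reflections from [x] to [y] by one step: if the step is by [s], the two
    sides of the first disjunction are exchanged and the second one holds because
    of [x <= y]; any other step is preserved by [s]. *)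
Lemma bruhat_lift s x y : K s -> generated K x -> bruhat_le K x y ->
  (bruhat_le K (s * x) y \/ bruhat_le K (s * x) (s * y)) /\
  (bruhat_le K x (s * y) \/ bruhat_le K (s * x) (s * y)).
Proof.
move=> Ks Kx; move: y; apply: bruhat_ind => // [|y t Ky Kt lt xy].
  by split; right; exact: bruhat_refl.
have Ksy : generated K (s * y) by apply: generatedM => //; exact: mem_generated.
have [->|ts] := pselect (t = s).
  by rewrite coxeter_simpleK; [tauto|exact: KS].
have le z : bruhat_le K z y -> bruhat_le K z (t * y) by exact: bruhat_mul.
have les z : bruhat_le K z (s * y) -> bruhat_le K z (s * (t * y)).
  have -> : s * (t * y) = t ^ s * (s * y).
    by rewrite conjgE coxeter_simpleV -?mulgA ?coxeter_simpleK//; exact: KS.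
  apply: bruhat_mul => //.
    by apply: reflectionsJ => //; exact: mem_generated.
  by apply: refl_lt_mull => //; [exact: KS|exact: reflections_subset Kt].
by case=> -[h|h] [h'|h']; split; auto.
Qed.

End Bruhat.

(** Each step down in a chain omits a letter by exchange, whatever the word. *)
Lemma bruhat_subword x y u : bruhat_le S x y -> word S u -> word_prod u = y ->
  exists2 r, subseq r u & word_prod r = x.
Proof.
move=> xy; move: y xy u; apply: (bruhat_ind (@subset_refl _ S) (Sg x)) => [u _ ux|].
  by exists u.
move=> y t _ St lt _ IH u Su uty.
have : refl_parity u t by rewrite refl_parity_lt// uty reflectionK.
move=> /refl_parity_exchange[r [ru _ rE]].
have ry : word_prod r = y by rewrite rE uty reflectionV// reflectionK.
have [r' r'r <-] := IH r (word_subseq ru Su) ry.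
by exists r' => //; exact: subseq_trans ru.
Qed.

Lemma bruhat_finite w : finite_set [set x | bruhat_le S x w].
Proof.
have [u [Su uw _]] := reduced_word S2 (Sg w).
apply: sub_finite_set
  (finite_seq (codom (fun m : (size u).-tuple bool => word_prod (mask m u)))).
move=> x /bruhat_subword/(_ Su uw)[r /subseqP[m sm ->] <-] /=.
exact: (codom_f _ (Tuple (introT eqP sm))).
Qed.

(** * The Bruhat order on cosets of a parabolic subgroup *)

Section BruhatCosets.
Variable K : set W.
Hypothesis KS : K `<=` S.

Let SS : S `<=` S. Proof. by []. Qed.

(** Lifting strips the letters of [v] one at a time: if [d <= s y] then [d <= y]
    or [d < s d <= y]. *)
Let min_rep_le_mulK d x (v : W) : min_right_reps S K d -> generated K v ->
  bruhat_le S d (v * x) -> bruhat_le S d x.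
Proof.
move=> Dd; move: v; apply: (parabolic_ind KS) => [|s v Ks Kv _ IHv].
  by rewrite mul1g.
have Ss := KS Ks; have ltd := proj1 (min_right_repsP KS d) Dd s Ks.
rewrite -mulgA => /(bruhat_lift SS Ss (Sg d))[_]; rewrite coxeter_simpleK// => -[//|sd].
apply: IHv; apply: bruhat_trans sd.
by have [] := proj2 (bruhat_lt_simple SS Ss (Sg d)) ltd.
Qed.

Lemma bruhat_mulr (u v : W) d : min_right_reps S K d -> generated K u ->
  bruhat_le K u v -> bruhat_le S (u * d) (v * d).
Proof.
move=> Dd Ku; move: v; apply: (bruhat_ind KS) => // [|v t Kv Kt lt _ IHv].
  exact: bruhat_refl.
rewrite -mulgA; apply: (bruhat_mul SS (Sg (v * d))) => //.
  exact: reflections_subset Kt.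
have Ktv : generated K (t * v) by apply: generatedM => //; exact: reflections_gen.
by rewrite mulgA !(min_rep_length KS Dd)// ltn_add2r.
Qed.

(** The representative [e] lies below [u * e], and lifting removes [v] from the
    upper bound. *)
Lemma bruhat_min_rep (u v : W) d e : min_right_reps S K d -> min_right_reps S K e ->
  generated K u -> generated K v -> bruhat_le S (u * e) (v * d) -> bruhat_le S e d.
Proof.
move=> Dd De Ku Kv le; apply: (min_rep_le_mulK De Kv); apply: bruhat_trans le.
rewrite -{1}[e]mul1g; apply: bruhat_mulr => //; first exact: generated1.
move: u Ku; apply: (parabolic_ind KS) => [|s u Ks Ku lt].
  exact: bruhat_refl.
by apply: (bruhat_mul KS) => //; exact: reflections_simple.
Qed.

(** Induction on [v], with lifting used twice: in [W] to remove [s] from the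
    larger element, in [W_K] to bring [s] back to the smaller one. *)
Lemma bruhat_mulr_inv (u v : W) d : min_right_reps S K d -> generated K u ->
  generated K v -> bruhat_le S (u * d) (v * d) -> bruhat_le K u v.
Proof.
move=> Dd + Kv; move: v Kv u; apply: (parabolic_ind KS) => [|s v Ks Kv lt IHv] u Ku.
  rewrite mul1g => /(bruhat_length SS (Sg (u * d)))[|].
    by rewrite -[X in _ = X]mul1g => /mulIg->; exact: bruhat_refl.
  by rewrite (min_rep_length KS Dd)// ltnNge leq_addl.
have Ss := KS Ks; have Ksu : generated K (s * u).
  by apply: generatedM => //; exact: mem_generated.
have vsv : bruhat_le K v (s * v) by have [] := proj2 (bruhat_lt_simple KS Ks Kv) lt.
rewrite -mulgA => /(bruhat_lift SS Ss (Sg (u * d)))[_].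
rewrite coxeter_simpleK// => -[/(IHv _ Ku) uv|]; first exact: bruhat_trans vsv.
rewrite mulgA => /(IHv _ Ksu)/(bruhat_lift KS Ks Ksu)[+ _].
by rewrite coxeter_simpleK// => -[uv|//]; exact: bruhat_trans vsv.
Qed.

Lemma bruhat_lt_mulr (u v : W) d : min_right_reps S K d -> generated K u ->
  generated K v -> bruhat_lt K u v <-> bruhat_lt S (u * d) (v * d).
Proof.
move=> Dd Ku Kv; split=> -[le ne]; split.
- exact: bruhat_mulr.
- by move=> /mulIg.
- exact: bruhat_mulr_inv le.
- by move=> e; apply: ne; rewrite e.
Qed.

Lemma left_weak_le_mulr (v w : W) d : min_right_reps S K d -> generated K v ->
  generated K w -> left_weak_le K v w -> left_weak_le S (v * d) (w * d).
Proof.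
move=> Dd Kv Kw; have Kwv : generated K (w * v^-1).
  by apply: generatedM => //; exact: generatedV.
rewrite /left_weak_le !(parabolic_length KS)// !(min_rep_length KS Dd)// => ->.
by rewrite invgM mulgA mulgK addnA.
Qed.

End BruhatCosets.
End CoxeterSystem.

Import GRing.Theory.
Local Open Scope ring_scope.

(** * The homomorphism from the Hecke algebra of a parabolic subgroup *)

Section HeckeInclusion.
Variables (W : groupType) (K S : set W).
Hypothesis KS : K `<=` S.

Definition gen_incl (s : K) : S :=
  exist _ (val s) (mem_set (KS (set_mem (valP s)))).

Fixpoint hecke_incl_term (x : hecke_term K) : hecke S :=
  match x with
  | HGen s => heckeT (gen_incl s)
  | HScal a => a%:A
  | HAdd x y => hecke_incl_term x + hecke_incl_term y
  | HMul x y => hecke_incl_term x * hecke_incl_term y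
  end.

Lemma hecke_incl_word (u : seq K) :
  hecke_incl_term (hecke_word u) = \prod_(s <- map gen_incl u) heckeT s.
Proof.
elim: u => [|s u IHu] /=; first by rewrite big_nil scale1r.
by rewrite big_cons IHu.
Qed.

(** The order of [s t] is computed in [W] on both sides, so the braid relations
    for [K] are among those for [S]. *)
Lemma hecke_incl_equiv x y :
  hecke_equiv x y -> hecke_incl_term x = hecke_incl_term y.
Proof.
elim=> //= {x y}.
- by move=> x y z _ -> _ ->.
- by move=> x x' y y' _ -> _ ->.
- by move=> x x' y y' _ -> _ ->.
- by move=> x y z; rewrite addrA.
- by move=> x y; rewrite addrC.
- by move=> x; rewrite scale0r add0r.
- by move=> x; rewrite scaleN1r scale0r mulN1r addNr.
- by move=> x y z; rewrite mulrA.
- by move=> x; rewrite scale1r mul1r.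
- by move=> x; rewrite scale1r mulr1.
- by move=> x y z; rewrite mulrDl.
- by move=> x y z; rewrite mulrDr.
- by move=> a c; rewrite scalerDl.
- by move=> a c; rewrite -scalerAl mul1r scalerA.
- by move=> a x; rewrite -scalerAl -scalerAr mul1r mulr1.
- by move=> s; rewrite T_quad scale1r -scalerAl mul1r.
move=> s t m st; rewrite !hecke_incl_word -!map_comp.
have := @T_braid _ _ (gen_incl s) (gen_incl t) m st.
rewrite /alternating.
have alt (r r' : K) : [seq (if odd i then gen_incl r' else gen_incl r) | i <- iota 0 m] =
    [seq (gen_incl \o (fun i => if odd i then r' else r)) i | i <- iota 0 m].
  by apply: eq_map => i /=; case: ifP.
by rewrite !alt.
Qed.

Definition hecke_incl (h : hecke K) : hecke S := hecke_incl_term (repr h).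

Lemma hecke_incl_hclass x : hecke_incl (hclass x) = hecke_incl_term x.
Proof. by apply: hecke_incl_equiv; exact: repr_hclass. Qed.

Lemma hecke_incl_is_zmod_morphism : zmod_morphism hecke_incl.
Proof.
have hD : {morph hecke_incl : g h / g + h}.
  by elim/hclass_ind => x; elim/hclass_ind => y; rewrite [X in hecke_incl X]hclassD
    !hecke_incl_hclass.
by move=> g h; apply: (addIr (hecke_incl h)); rewrite -hD !subrK.
Qed.

Lemma hecke_incl_is_monoid_morphism : monoid_morphism hecke_incl.
Proof.
split; first by rewrite hecke_incl_hclass /= scale1r.
by elim/hclass_ind => x; elim/hclass_ind => y; rewrite [X in hecke_incl X]hclassM
    !hecke_incl_hclass.
Qed.

HB.instance Definition _ := GRing.isZmodMorphism.Build (hecke K) (hecke S)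
  hecke_incl hecke_incl_is_zmod_morphism.
HB.instance Definition _ := GRing.isMonoidMorphism.Build (hecke K) (hecke S)
  hecke_incl hecke_incl_is_monoid_morphism.

Lemma hecke_incl_scal (a : laurent) : hecke_incl a%:A = a%:A.
Proof. by rewrite -hecke_scalE hecke_incl_hclass. Qed.

Lemma hecke_inclT (s : K) : hecke_incl (heckeT s) = heckeT (gen_incl s).
Proof. exact: hecke_incl_hclass. Qed.

Lemma hecke_ind (P : hecke K -> Prop) :
  (forall s, P (heckeT s)) -> (forall a : laurent, P a%:A) ->
  (forall g h, P g -> P h -> P (g + h)) -> (forall g h, P g -> P h -> P (g * h)) ->
  forall h, P h.
Proof.
move=> PT Pa PD PM; elim/hclass_ind; elim=> [s|a|x Px y Py|x Px y Py].
- exact: PT.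
- by rewrite -[hclass _]/(hecke_scal K a) hecke_scalE.
- by rewrite -hclassD; exact: PD.
- by rewrite -hclassM; exact: PM.
Qed.

Lemma hbar_incl (h : hecke K) : hbar (hecke_incl h) = hecke_incl (hbar h).
Proof.
elim/hecke_ind: h => [s|a|g h IHg IHh|g h IHg IHh].
- by rewrite hecke_inclT !hbar_T rmorphB /= hecke_inclT hecke_incl_scal.
- by rewrite hecke_incl_scal !hbarZ !rmorph1 hecke_incl_scal.
- by rewrite !rmorphD /= IHg IHh.
- by rewrite !rmorphM /= IHg IHh.
Qed.

End HeckeInclusion.

(** * Spans of sets of basis vectors *)

Lemma scal_scaleA (W : groupType) (S : set W) (V : lmodType (hecke S))
    (a c : laurent) (v : V) : a%:A *: (c%:A *: v) = (a * c)%:A *: v.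
Proof. by rewrite scalerA -scalerAl mul1r scalerA. Qed.

Section Span.
Variables (W : groupType) (S : set W) (V : lmodType (hecke S)) (b : W -> V).
Implicit Types (X Y : set W) (u : seq W) (c : W -> laurent) (v : V).

Definition basis_sum u c : V := \sum_(w <- u) (c w)%:A *: b w.

Definition basis_span X : set V := [set v | exists u c,
  [/\ uniq u, forall w, w \in u -> X w & v = basis_sum u c]].

Lemma basis_sum_widen u u' c : uniq u -> uniq u' -> {subset u <= u'} ->
  basis_sum u c = basis_sum u' (fun w => if w \in u then c w else 0).
Proof.
move=> uu uu' sub; rewrite /basis_sum.
have -> : \sum_(w <- u') (if w \in u then c w else 0)%:A *: b w =
    \sum_(w <- u' | w \in u) (c w)%:A *: b w.
  by rewrite [RHS]big_mkcond; apply: eq_bigr => w _; case: ifP; rewrite ?scale0r ?scale0r.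
rewrite -[RHS]big_filter; rewrite [RHS](perm_big u) //=.
apply: uniq_perm => //; first exact: filter_uniq.
by move=> w; rewrite mem_filter; case: (boolP (w \in u)) => // /sub ->.
Qed.

(** Both combinations are widened to the union of their supports, where the
    coefficients can be subtracted. *)
Lemma basis_spanB X v v' : basis_span X v -> basis_span X v' -> basis_span X (v - v').
Proof.
move=> [u [c [uu uX ->]]] [u' [c' [uu' uX' ->]]].
exists (undup (u ++ u')), (fun w => (if w \in u then c w else 0) -
  (if w \in u' then c' w else 0)); split; first exact: undup_uniq.
  by move=> w; rewrite mem_undup mem_cat => /orP[/uX|/uX'].
rewrite (@basis_sum_widen u (undup (u ++ u')))// ?undup_uniq//; last first.
  by move=> w; rewrite mem_undup mem_cat => ->.
rewrite (@basis_sum_widen u' (undup (u ++ u')))// ?undup_uniq//; last first.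
  by move=> w; rewrite mem_undup mem_cat => ->; rewrite orbT.
by rewrite /basis_sum -sumrB; apply: eq_bigr => w _; rewrite !scalerBl.
Qed.

Lemma basis_span0 X : basis_span X 0.
Proof. by exists [::], (fun=> 0); rewrite /basis_sum big_nil. Qed.

Lemma basis_spanN X v : basis_span X v -> basis_span X (- v).
Proof. by rewrite -sub0r; apply: basis_spanB; exact: basis_span0. Qed.

Lemma basis_spanD X v v' : basis_span X v -> basis_span X v' -> basis_span X (v + v').
Proof. by move=> Xv Xv'; rewrite -[v']opprK; apply: basis_spanB => //; exact: basis_spanN. Qed.

Lemma basis_spanZ X (a : laurent) v : basis_span X v -> basis_span X (a%:A *: v).
Proof.
move=> [u [c [uu uX ->]]]; exists u, (fun w => a * c w); split=> //.
by rewrite /basis_sum scaler_sumr; apply: eq_bigr => w _; rewrite scal_scaleA.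
Qed.

Lemma basis_span_sum X (T : Type) (r : seq T) (P : pred T) (F : T -> V) :
  (forall i, P i -> basis_span X (F i)) -> basis_span X (\sum_(i <- r | P i) F i).
Proof. by apply: big_ind; [exact: basis_span0|exact: basis_spanD]. Qed.

Lemma mem_basis_span X w : X w -> basis_span X (b w).
Proof.
move=> Xw; exists [:: w], (fun=> 1); split=> // [z|]; first by rewrite inE => /eqP->.
by rewrite /basis_sum big_seq1 scale1r scale1r.
Qed.

Lemma basis_span_ind X (P : V -> Prop) : P 0 -> (forall v v', P v -> P v' -> P (v + v')) ->
  (forall (a : laurent) w, X w -> P (a%:A *: b w)) -> forall v, basis_span X v -> P v.
Proof.
move=> P0 PD Pb _ [u [c [_ uX ->]]]; rewrite /basis_sum big_seq.
by apply: big_ind => // w /uX/Pb.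
Qed.

Lemma basis_span_subset X Y : X `<=` Y -> basis_span X `<=` basis_span Y.
Proof. by move=> XY v [u [c [uu uX ->]]]; exists u, c; split=> // w /uX/XY. Qed.

Lemma basis_span_fsum X Y (c : W -> laurent) : X `<=` Y ->
  basis_span Y (\sum_(w \in X) (c w)%:A *: b w).
Proof.
move=> XY; case: finite_supportP => [_|u uX _ _]; first by rewrite big_nil; exact: basis_span0.
by rewrite big_seq; apply: basis_span_sum => w /uX/XY Yw; apply: basis_spanZ; exact: mem_basis_span.
Qed.

End Span.

Section Projection.
Variables (W : groupType) (S : set W) (V : lmodType (hecke S)) (b : W -> V).
Variables (I X : set W).
Hypotheses (basis : A_basis I b) (XI : X `<=` I).
Implicit Types v : V.

Lemma A_basis_span v : basis_span b I v.
Proof.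
have [/(_ v)[u [c [uI ->]]] _] := basis; rewrite big_seq.
by apply: basis_span_sum => w /uI Iw; apply: basis_spanZ; exact: mem_basis_span.
Qed.

(** Equate the two expressions of [v]: their supports are disjoint, so
    independence kills all coefficients. *)
Lemma basis_span_disjoint v : basis_span b X v -> basis_span b (I `\` X) v -> v = 0.
Proof.
move=> [u [c [uu uX vu]]] [u' [c' [uu' uX' vu']]].
pose c2 w := if w \in u then c w else - c' w.
have uE : \sum_(w <- u) (c2 w)%:A *: b w = v.
  by rewrite vu /basis_sum !big_seq; apply: eq_bigr => w wu; rewrite /c2 wu.
have uE' : \sum_(w <- u') (c2 w)%:A *: b w = - v.
  rewrite vu' /basis_sum -sumrN !big_seq; apply: eq_bigr => w wu'.
  rewrite /c2 ifF; first by rewrite !scaleNr.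
  by apply/negP => /uX Xw; case: (uX' _ wu').
have dis : uniq (u ++ u').
  rewrite cat_uniq uu uu' andbT; apply/hasPn => w /uX'[_ nXw].
  by apply/negP => /uX.
rewrite -uE big_seq big1// => w wu.
rewrite (proj2 basis _ c2 dis) ?scale0r ?scale0r//.
- by move=> z; rewrite mem_cat => /orP[/uX/XI|/uX'[]].
- by rewrite big_cat /= uE uE' subrr.
- by rewrite mem_cat wu.
Qed.

(** The projection onto the span of [X] along the rest of the basis. *)
Definition basis_proj v : V :=
  xget 0 [set x | basis_span b X x /\ basis_span b (I `\` X) (v - x)].

Let basis_projP v :
  basis_span b X (basis_proj v) /\ basis_span b (I `\` X) (v - basis_proj v).
Proof.
rewrite /basis_proj; case: xgetP => [x _ //|/(_ _)/= nx]; exfalso.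
suff [x /nx] : exists x, basis_span b X x /\ basis_span b (I `\` X) (v - x) by [].
elim/basis_span_ind: v / (A_basis_span v) {nx} => [|v v' [x [Xx Yx]] [x' [Xx' Yx']]|a w Iw].
- by exists 0; rewrite subr0; split; exact: basis_span0.
- by exists (x + x'); rewrite opprD addrACA; split; exact: basis_spanD.
have [Xw|nXw] := pselect (X w).
  exists (a%:A *: b w); rewrite subrr; split; last exact: basis_span0.
  by apply: basis_spanZ; exact: mem_basis_span.
exists 0; rewrite subr0; split; first exact: basis_span0.
by apply: basis_spanZ; exact: mem_basis_span.
Qed.

Lemma basis_proj_span v : basis_span b X (basis_proj v).
Proof. by case: (basis_projP v). Qed.

Let basis_proj_unique v x :
  basis_span b X x -> basis_span b (I `\` X) (v - x) -> basis_proj v = x.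
Proof.
move=> Xx Yx; have [Xv Yv] := basis_projP v.
apply/eqP; rewrite -subr_eq0; apply/eqP/basis_span_disjoint; first exact: basis_spanB.
have -> : basis_proj v - x = (v - x) - (v - basis_proj v) by rewrite opprB [RHS]addrC subrKA.
exact: basis_spanB.
Qed.

Lemma basis_proj_id v : basis_span b X v -> basis_proj v = v.
Proof. by move=> Xv; apply: basis_proj_unique => //; rewrite subrr; exact: basis_span0. Qed.

Lemma basis_proj_ker v : basis_span b (I `\` X) v -> basis_proj v = 0.
Proof. by move=> Yv; apply: basis_proj_unique; [exact: basis_span0|rewrite subr0]. Qed.

Lemma basis_proj_is_zmod_morphism : zmod_morphism basis_proj.
Proof.
move=> v v'; have [Xv Yv] := basis_projP v; have [Xv' Yv'] := basis_projP v'.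
apply: basis_proj_unique; first exact: basis_spanB.
have -> : v - v' - (basis_proj v - basis_proj v') =
  (v - basis_proj v) - (v' - basis_proj v') by rewrite !opprB addrACA [RHS]addrACA [- v' + _]addrC.
exact: basis_spanB.
Qed.

Lemma basis_projZ (a : laurent) v : basis_proj (a%:A *: v) = a%:A *: basis_proj v.
Proof.
have [Xv Yv] := basis_projP v; apply: basis_proj_unique; first exact: basis_spanZ.
by rewrite -scalerBr; exact: basis_spanZ.
Qed.

End Projection.

(** * Subquotients as retracts *)

Section Subquotient.
Variables (R R' : nzRingType) (f : {rmorphism R' -> R}) (V : lmodType R).
Variables (pr : {additive V -> V}).
Hypothesis prK : forall v, pr (pr v) = pr v.
Hypothesis pr_compat : forall g h v, pr v = v ->
  pr (f g *: pr (f h *: v)) = pr (f g *: (f h *: v)).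

(** A subquotient [P / N] of [V] is modelled on the image of an idempotent [pr]
    whose kernel on [P] is [N]: scalars act by acting in [V] and then applying
    [pr].  The hypothesis [pr_compat] says that the vector discarded after a
    first action stays discarded after a second one; it is what associativity
    requires. *)
Lemma retract_module : exists (U : lmodType R') (iota : {additive U -> V}) (pi : V -> U),
  [/\ injective iota, forall h x, iota (h *: x) = pr (f h *: iota x),
      forall x, pr (iota x) = iota x & forall v, iota (pi v) = pr v].
Proof.
pose T := {v : V | pr v == v}.
have T0 : pr 0 == 0 by rewrite raddf0.
have TD (x y : T) : pr (val x + val y) == val x + val y.
  by rewrite raddfD /= (eqP (valP x)) (eqP (valP y)).
have TN (x : T) : pr (- val x) == - val x by rewrite raddfN (eqP (valP x)).
have Tpr v : pr (pr v) == pr v by rewrite prK.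
pose mk v (p : pr v == v) : T := exist _ v p.
pose add (x y : T) : T := mk _ (TD x y).
pose opp (x : T) : T := mk _ (TN x).
pose scale (h : R') (x : T) : T := mk _ (Tpr (f h *: val x)).
have addA : associative add by move=> x y z; apply: val_inj; exact: addrA.
have addC : commutative add by move=> x y; apply: val_inj; exact: addrC.
have add0 : left_id (mk _ T0) add by move=> x; apply: val_inj; exact: add0r.
have addN : left_inverse (mk _ T0) opp add by move=> x; apply: val_inj; exact: addNr.
pose zT := GRing.isZmodule.Build T addA addC add0 addN.
pose Z : zmodType := HB.pack T zT.
have scA (g h : R') (x : Z) : scale g (scale h x) = scale (g * h) x.
  by apply: val_inj; rewrite /= pr_compat ?(eqP (valP x))// rmorphM scalerA.
have sc1 : left_id 1 (scale : R' -> Z -> Z).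
  by move=> x; apply: val_inj; rewrite /= rmorph1 scale1r (eqP (valP x)).
have scDr : right_distributive (scale : R' -> Z -> Z) +%R.
  by move=> h x y; apply: val_inj; rewrite /= scalerDr raddfD.
have scDl (x : Z) : {morph (scale : R' -> Z -> Z)^~ x : g h / g + h}.
  by move=> g h; apply: val_inj; rewrite /= rmorphD scalerDl raddfD.
pose lT := GRing.Zmodule_isLmodule.Build R' Z scA sc1 scDr scDl.
pose U : lmodType R' := HB.pack Z lT.
pose iota (x : U) : V := val (x : T).
have iotaB : zmod_morphism iota by move=> x y.
pose iota' : {additive U -> V} := HB.pack iota (GRing.isZmodMorphism.Build U V iota iotaB).
exists U, iota', (fun v => mk _ (Tpr v)); split => //.
by move=> x; apply/eqP; exact: (valP (x : T)).
Qed.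

End Subquotient.

(** * The triangular action of generators and of the involution *)

Lemma scal_comm (W : groupType) (S : set W) (V : lmodType (hecke S))
    (h : hecke S) (a : laurent) (v : V) : h *: (a%:A *: v) = a%:A *: (h *: v).
Proof. by rewrite !scalerA -scalerAr -scalerAl mulr1 mul1r. Qed.

Lemma raddf_fsum (U1 U2 : zmodType) (T : choiceType) (f : {additive U1 -> U2})
    (D : set T) (F : T -> U1) :
  finite_set D -> f (\sum_(i \in D) F i) = \sum_(i \in D) f (F i).
Proof. by move=> fD; rewrite !fsbig_finite// raddf_sum. Qed.

Section WGraphModule.
Variables (W : groupType) (S I J : set W).
Hypotheses (cox : coxeter_system S) (ideal : weak_ideal S I).
Variables (V : lmodType (hecke S)) (b : W -> V).
Hypothesis basis : A_basis I b.
Hypothesis action : forall (w : W) (s : S), I w ->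
  [/\ SA S I w (val s) -> heckeT s *: b w = b (val s * w)%g,
      SD S w (val s) ->
        heckeT s *: b w = b (val s * w)%g + (lq - lqV)%:A *: b w,
      WD S J w (val s) -> heckeT s *: b w = - (lqV%:A *: b w) &
      WA S I J w (val s) ->
        exists r : W -> laurent,
          (forall y, I y -> bruhat_lt S y (val s * w)%g -> qAplus (r y)) /\
          heckeT s *: b w = lq%:A *: b w -
            \sum_(y \in [set y | I y /\ bruhat_lt S y (val s * w)%g])
              (r y)%:A *: b y].
Variable bar : V -> V.
Hypotheses (barD : {morph bar : x y / x + y})
  (barZ : forall (a : laurent) (x : V), bar (a%:A *: x) = (lbar a)%:A *: bar x)
  (bar1 : bar (b 1%g) = b 1%g)
  (bar_hecke : forall (h : hecke S) (x : V), bar (h *: x) = hbar h *: bar x).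

Local Notation l := (cox_length S).
Let SS : S `<=` S. Proof. by []. Qed.
Let Sg w : generated S w. Proof. exact: (coxeter_gen cox w). Qed.
Let Sval (s : S) : S (val s). Proof. exact: set_mem (valP s). Qed.

Lemma ideal_descent s w : S s -> I w -> (l (s * w)%g < l w)%N -> I (s * w)%g.
Proof.
move=> Ss Iw lt; have [_ _ down] := ideal; apply: (down _ w) => //.
rewrite /left_weak_le invgM mulgA mulgV mul1g (coxeter_simpleV cox Ss).
rewrite (length_simple cox Ss) -{1}[w](coxeter_simpleK cox _ Ss).
by rewrite (length_simple_lt cox Ss) ?(coxeter_simpleK cox)// add1n.
Qed.

Lemma hecke_action_span w (s : S) : I w ->
  basis_span b [set x | I x /\ (bruhat_le S x w \/ bruhat_le S x (val s * w)%g)]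
    (heckeT s *: b w).
Proof.
move=> Iw; have [hSA hSD hWD hWA] := action s Iw.
have mem x : I x -> bruhat_le S x w \/ bruhat_le S x (val s * w)%g ->
    forall a : laurent, basis_span b
      [set x | I x /\ (bruhat_le S x w \/ bruhat_le S x (val s * w)%g)] (a%:A *: b x).
  by move=> Ix xw a; apply: basis_spanZ; exact: mem_basis_span.
have mem1 x : I x -> bruhat_le S x w \/ bruhat_le S x (val s * w)%g -> basis_span b
      [set x | I x /\ (bruhat_le S x w \/ bruhat_le S x (val s * w)%g)] (b x).
  by move=> Ix xw; exact: mem_basis_span.
have ww := bruhat_refl S w; have sww := bruhat_refl S (val s * w)%g.
have := refl_lt cox w (reflections_simple (Sval s)).
have [lt _|_ lt] := boolP (l (val s * w)%g < l w)%N.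
  rewrite hSD; last by split=> //; apply/(bruhat_simple_lt cox SS).
  apply: basis_spanD; last by apply: mem => //; left.
  by apply: mem1; [exact: ideal_descent|right].
have wsw : bruhat_lt S w (val s * w)%g by apply/(bruhat_lt_simple cox SS).
have [Isw|nIsw] := pselect (I (val s * w)%g).
  by rewrite hSA//; apply: mem1 => //; right.
have [Jsw|nJsw] := pselect (min_left_reps S J (val s * w)%g); last first.
  by rewrite hWD//; apply: basis_spanN; apply: mem => //; left.
have [//|r [_ ->]] := hWA.
apply: basis_spanB; first by apply: mem => //; left.
by apply: basis_span_fsum => y [Iy [ysw _]]; split=> //; right.
Qed.

(** Induction on length, from [b (s * w) = T_s b w] for [s * w > w]: the lifting
    property keeps [T_s b z], [z < w], strictly below [s * w]. *)
Lemma bar_basis_span w : I w ->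
  basis_span b [set z | I z /\ bruhat_lt S z w] (bar (b w) - b w).
Proof.
have [n le] := ubnP (l w); elim: n => // n IHn in w le *; move=> Iw.
have [->|w1] := pselect (w = 1%g).
  by rewrite bar1 subrr; exact: basis_span0.
have [s Ss lt] := left_descent cox w1; pose s' : S := exist _ s (mem_set Ss).
have sw_lt : bruhat_lt S (s * w)%g w by apply/(bruhat_simple_lt cox SS).
have Isw := ideal_descent Ss Iw lt.
have [hSA _ _ _] := action s' Isw.
have bw : b w = heckeT s' *: b (s * w)%g.
  rewrite hSA; first by rewrite [in RHS](coxeter_simpleK cox w Ss).
  by split; rewrite /= ?(coxeter_simpleK cox).
have := IHn (s * w)%g (leq_trans lt le) Isw.
set N := bar _ - _ => spanN.
have -> : bar (b w) - b w =
    heckeT s' *: N - (lq - lqV)%:A *: (N + b (s * w)%g).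
  rewrite bw bar_hecke hbar_T -[bar (b _)](subrK (b (s * w)%g)) -/N.
  by rewrite scalerBl [heckeT s' *: (_ + _)]scalerDr addrAC addrK.
apply: basis_spanB; last first.
  apply: basis_spanZ; apply: basis_spanD; last exact: mem_basis_span.
  apply: basis_span_subset spanN => z [Iz zsw]; split=> //.
  have lz := bruhat_lt_length cox SS (Sg z) zsw.
  split; first by apply: bruhat_trans (proj1 zsw) (proj1 sw_lt).
  by move=> e; move: lz; rewrite e ltnNge ltnW.
elim/basis_span_ind: N / spanN => [|v v' IH IH'|a z [Iz zsw]].
- by rewrite scaler0; exact: basis_span0.
- by rewrite scalerDr; exact: basis_spanD.
rewrite scal_comm; apply: basis_spanZ.
apply: basis_span_subset (hecke_action_span s' Iz) => x [Ix] /= xz; split=> //.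
have [zle _] := zsw; have lz := bruhat_lt_length cox SS (Sg z) zsw.
have ltlt x' : bruhat_le S x' z -> bruhat_lt S x' w.
  move=> x'z; split; first by apply: bruhat_trans x'z _; apply: bruhat_trans zle (proj1 sw_lt).
  move=> e; move: x'z; rewrite e => /(bruhat_length cox SS (Sg w))[ez|].
    by move: lz; rewrite -ez ltnNge ltnW.
  by rewrite ltnNge ltnW// (ltn_trans lz).
case: xz => [/ltlt//|xsz].
have szw : bruhat_le S (s * z)%g w.
  have [+ _] := bruhat_lift cox SS Ss (Sg z) zle.
  rewrite (coxeter_simpleK cox)// => -[sz|//].
  exact: bruhat_trans sz (proj1 sw_lt).
split; first exact: bruhat_trans xsz szw.
move=> e; have [es|] := bruhat_length cox SS (Sg x) xsz.
  by case: zsw => _; apply; rewrite -e es (coxeter_simpleK cox).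
rewrite e; have [->|lt1 lt2] := bruhat_length cox SS (Sg _) szw; first by rewrite ltnn.
by move: (ltn_trans lt1 lt2); rewrite ltnn.
Qed.

(** * The subquotient attached to a coset *)

Section Restriction.
Variables (K : set W) (d : W).
Hypotheses (KS : K `<=` S) (Dd : min_right_reps S K d) (Id : I d) (JS : J `<=` S)
  (barK : involutive bar).

(** The index set of the basis of the subquotient. *)
Definition coset : set W := [set y | I y /\ exists2 v, generated K v & y = (v * d)%g].

(** The index set of the basis of the submodule that is factored out.  Comparing
    the lengths of minimal representatives suffices, because they are monotone
    and distinct comparable elements have different lengths. *)
Definition lower : set W := [set y | I y /\ exists u e,
  [/\ generated K u, min_right_reps S K e, y = (u * e)%g & (l e < l d)%N]].

(** The condition on [X] under which the span of [b y], [y] in [X], is stable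
    under the Hecke algebra of [W_K] and under [bar]. *)
Definition K_closed (X : set W) : Prop := forall y u z, X y -> generated K u -> I z ->
  bruhat_le S z (u * y)%g -> X z.

Lemma lower_K_closed : K_closed lower.
Proof.
move=> _ u z [_ [v [e [Kv De -> lte]]]] Ku Iz; rewrite mulgA => zle; split=> //.
have [w [e' [Kw De' zE]]] := exists_min_rep cox KS z; exists w, e'; split=> //.
have Kuv := generatedM Ku Kv.
move: zle; rewrite zE => /(bruhat_min_rep cox KS De De' Kw Kuv).
by move=> /(bruhat_length cox SS (Sg e'))[->//|/ltn_trans]; exact.
Qed.

Lemma coset_lower_K_closed : K_closed (coset `|` lower).
Proof.
move=> y u z [[_ [v Kv ->]]|ly] Ku Iz zle; last by right; exact: lower_K_closed zle.
have [w [e [Kw De zE]]] := exists_min_rep cox KS z.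
move: zle; rewrite zE mulgA => /(bruhat_min_rep cox KS Dd De Kw (generatedM Ku Kv)).
move=> /(bruhat_length cox SS (Sg e))[ed|lt].
  by left; split; [rewrite -zE|exists w => //; rewrite ed].
by right; split; [rewrite -zE|exists w, e].
Qed.

Lemma coset_lower_disjoint : lower `<=` I `\` coset.
Proof.
move=> y [Iy [u [e [Ku De yE lt]]]]; split=> // -[_ [v Kv yE']].
have eE : e = (u^-1 * v * d)%g by rewrite -mulgA -yE' yE mulKg.
have Kuv : generated K (u^-1 * v)%g by apply: generatedM => //; exact: generatedV.
by move: lt; rewrite eE (min_rep_length cox KS Dd Kuv) ltnNge leq_addl.
Qed.

Lemma below_lower z : I z -> bruhat_lt S z d -> lower z.
Proof.
move=> Iz [zd ne]; have zd1 : bruhat_le S z (1 * d)%g by rewrite mul1g.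
have dC : (coset `|` lower) d.
  by left; split=> //; exists 1%g; [exact: generated1|rewrite mul1g].
have [[_ [v Kv zE]]|//] := coset_lower_K_closed dC (@generated1 _ K) Iz zd1.
case: ne; move: zd => /(bruhat_length cox SS (Sg z))[//|].
by rewrite zE (min_rep_length cox KS Dd Kv) ltnNge leq_addl.
Qed.

Lemma K_closed_hecke X h v : X `<=` I -> K_closed X ->
  basis_span b X v -> basis_span b X (hecke_incl KS h *: v).
Proof.
move=> XI cl; elim/hecke_ind: h v => [s|a|g h IHg IHh|g h IHg IHh] v Xv.
- rewrite hecke_inclT; elim/basis_span_ind: v / Xv => [|v v' IH IH'|a y Xy].
  + by rewrite scaler0; exact: basis_span0.
  + by rewrite scalerDr; exact: basis_spanD.
  rewrite scal_comm; apply: basis_spanZ.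
  apply: basis_span_subset (hecke_action_span (gen_incl KS s) (XI _ Xy)).
  move=> x [Ix [xy|xsy]].
    by apply: (cl y 1%g) => //; [exact: generated1|rewrite mul1g].
  by apply: (cl y (val s)) => //; apply: mem_generated; exact: set_mem (valP s).
- by rewrite hecke_incl_scal; exact: basis_spanZ.
- by rewrite rmorphD scalerDl; apply: basis_spanD; [exact: IHg|exact: IHh].
- by rewrite rmorphM -scalerA; apply: IHg; exact: IHh.
Qed.

Let bar0 : bar 0 = 0.
Proof. by apply: (addIr (bar 0)); rewrite -barD !add0r. Qed.

Let barB : zmod_morphism bar.
Proof. by move=> x y; apply: (addIr (bar y)); rewrite -barD !subrK. Qed.

Lemma K_closed_bar X v : X `<=` I -> K_closed X ->
  basis_span b X v -> basis_span b X (bar v).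
Proof.
move=> XI cl; elim/basis_span_ind => {v} [|v v' IH IH'|a y Xy].
- by rewrite bar0; exact: basis_span0.
- by rewrite barD; exact: basis_spanD.
rewrite barZ; apply: basis_spanZ; rewrite -[bar _](subrK (b y)).
apply: basis_spanD; last exact: mem_basis_span.
apply: basis_span_subset (bar_basis_span (XI _ Xy)) => z [Iz [zy _]].
by apply: (cl y 1%g) => //; [exact: generated1|rewrite mul1g].
Qed.

Let cosetI : coset `<=` I. Proof. by move=> y []. Qed.
Let lowerI : lower `<=` I. Proof. by move=> y []. Qed.
Let coset_lowerI : coset `|` lower `<=` I.
Proof. by move=> y [/cosetI|/lowerI]. Qed.

Let pr := basis_proj b I coset.

Let prB : zmod_morphism pr.
Proof. exact: basis_proj_is_zmod_morphism basis cosetI. Qed.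

HB.instance Definition _ := GRing.isZmodMorphism.Build V V pr prB.

Let prD : {morph pr : x y / x + y}.
Proof. exact: raddfD. Qed.

Let pr_id v : basis_span b coset v -> pr v = v.
Proof. exact: (basis_proj_id basis cosetI). Qed.

Let pr_span v : basis_span b coset (pr v).
Proof. exact: (basis_proj_span coset basis v). Qed.

Let pr_lower v : basis_span b lower v -> pr v = 0.
Proof.
by move=> /(basis_span_subset coset_lower_disjoint); exact: (basis_proj_ker basis cosetI).
Qed.

Let prZ (a : laurent) v : pr (a%:A *: v) = a%:A *: pr v.
Proof. exact: (basis_projZ basis cosetI). Qed.

Let pr_mod_lower v : basis_span b (coset `|` lower) v -> basis_span b lower (pr v - v).
Proof.
elim/basis_span_ind => {v} [|v v' IH IH'|a y [Cy|Ly]].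
- by rewrite raddf0 subr0; exact: basis_span0.
- by rewrite raddfD opprD addrACA; exact: basis_spanD.
- rewrite pr_id ?subrr; first exact: basis_span0.
  by apply: basis_spanZ; exact: mem_basis_span.
rewrite pr_lower ?sub0r; first by apply: basis_spanN; apply: basis_spanZ; exact: mem_basis_span.
by apply: basis_spanZ; exact: mem_basis_span.
Qed.

(** The vector [pr v - v] lies in the span of [lower], which [F] preserves and
    [pr] kills. *)
Let pr_factor (F : V -> V) v : zmod_morphism F ->
  (forall x, basis_span b lower x -> basis_span b lower (F x)) ->
  basis_span b (coset `|` lower) v -> pr (F (pr v)) = pr (F v).
Proof.
move=> FB Fl /pr_mod_lower/Fl/pr_lower; rewrite FB prB => /eqP.
by rewrite subr_eq0 => /eqP.
Qed.

Let coset_span v : pr v = v -> basis_span b (coset `|` lower) v.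
Proof.
move=> <-; apply: basis_span_subset (pr_span v); exact: subsetUl.
Qed.

Let pr_hecke g v : basis_span b (coset `|` lower) v ->
  pr (hecke_incl KS g *: pr v) = pr (hecke_incl KS g *: v).
Proof.
apply: (pr_factor (F := fun x => hecke_incl KS g *: x)); first exact: scalerBr.
by move=> x; apply: K_closed_hecke => //; exact: lower_K_closed.
Qed.

Let pr_bar v : basis_span b (coset `|` lower) v -> pr (bar (pr v)) = pr (bar v).
Proof.
apply: pr_factor barB _ => x; apply: K_closed_bar => //; exact: lower_K_closed.
Qed.

Local Notation I_d := [set v | generated K v /\ I (v * d)%g].
Local Notation L := (K `&` [set (d * j * d^-1)%g | j in J]).

Hypothesis ID : I `<=` min_left_reps S J.

Let below_finite x : finite_set [set y | I y /\ bruhat_lt S y x].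
Proof.
by apply: sub_finite_set (bruhat_finite cox x) => y [_ []].
Qed.

Let coset_mulr v : I_d v -> coset (v * d)%g.
Proof. by move=> [Kv Iv]; split=> //; exists v. Qed.

Let pr_basis v : I_d v -> pr (b (v * d)%g) = b (v * d)%g.
Proof. by move=> /coset_mulr Cv; apply: pr_id; exact: mem_basis_span. Qed.

Let pr_out y : I y -> ~ coset y -> pr (b y) = 0.
Proof. by move=> Iy nCy; apply: (basis_proj_ker basis cosetI); exact: mem_basis_span. Qed.

(** Right multiplication by [d] matches the index sets of the two sums in the
    last case of the action, once the second is cut down to [coset]. *)
Let coset_bij x : generated K x ->
  set_bij [set y | I_d y /\ bruhat_lt K y x]
          ([set y | I y /\ bruhat_lt S y (x * d)%g] `&` coset) (fun y => (y * d)%g).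
Proof.
move=> Kx; split=> [y [[Ky Iy] yx]|y y' _ _ /mulIg//|z [[Iz zx] [_ [y Ky zE]]]].
  split; [split=> //|exact: coset_mulr].
  exact/(bruhat_lt_mulr cox KS Dd Ky Kx).
rewrite zE in Iz zx; exists y => //; split=> //.
exact/(bruhat_lt_mulr cox KS Dd Ky Kx).
Qed.

(** The subquotient of [V] given by [coset] and [lower], with the images of the
    [b (v * d)] as basis.  Identities are checked after applying the injection
    [iota] into [V]; there the action is that of [V] followed by [pr], and
    [pr (b y)] is [b y] or [0] according to whether [y] is in the coset of [d]. *)
Lemma parabolic_module : exists (U : lmodType (hecke K)) (b' : W -> U),
  [/\ A_basis I_d b',
      (forall (w : W) (s : K), I_d w ->
        [/\ SA K I_d w (val s) -> heckeT s *: b' w = b' (val s * w)%g,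
            SD K w (val s) ->
              heckeT s *: b' w = b' (val s * w)%g + (lq - lqV)%:A *: b' w,
            WD K L w (val s) -> heckeT s *: b' w = - (lqV%:A *: b' w) &
            WA K I_d L w (val s) ->
              exists r : W -> laurent,
                (forall y, I_d y -> bruhat_lt K y (val s * w)%g -> qAplus (r y)) /\
                heckeT s *: b' w = lq%:A *: b' w -
                  \sum_(y \in [set y | I_d y /\ bruhat_lt K y (val s * w)%g])
                    (r y)%:A *: b' y]) &
      exists bar' : U -> U,
      [/\ {morph bar' : x y / x + y},
          forall (a : laurent) (x : U), bar' (a%:A *: x) = (lbar a)%:A *: bar' x,
          involutive bar',
          bar' (b' 1%g) = b' 1%g &
          forall (h : hecke K) (x : U), bar' (h *: x) = hbar h *: bar' x]].
Proof.
have prK v : pr (pr v) = pr v by apply: pr_id; exact: pr_span.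
have compat g h v : pr v = v ->
    pr (hecke_incl KS g *: pr (hecke_incl KS h *: v)) =
    pr (hecke_incl KS g *: (hecke_incl KS h *: v)).
  move=> /coset_span Mv; apply: pr_hecke.
  by apply: K_closed_hecke => //; exact: coset_lower_K_closed.
have [U [iota [pi [iota_inj iotaZ0 pr_iota0 iota_pi0]]]] := retract_module prK compat.
have iotaZ h x : iota (h *: x) = pr (hecke_incl KS h *: iota x) by exact: iotaZ0.
have pr_iota x : pr (iota x) = iota x by exact: pr_iota0.
have iota_pi v : iota (pi v) = pr v by exact: iota_pi0.
have iotaA (a : laurent) x : iota (a%:A *: x) = a%:A *: iota x.
  by rewrite iotaZ hecke_incl_scal prZ pr_iota.
have iota_span x := coset_span (pr_iota x).
have span_bar x : basis_span b (coset `|` lower) (bar (iota x)).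
  by apply: K_closed_bar => //; exact: coset_lower_K_closed.
have I1 : I_d 1%g by split; [exact: generated1|rewrite mul1g].
pose b' v := pi (b (v * d)%g); exists U, b'.
have iotab v : I_d v -> iota (b' v) = b (v * d)%g by move=> Iv; rewrite iota_pi pr_basis.
split.
- split=> [x|u c uu uI u0 w wu].
    have : basis_span b coset (iota x) by rewrite -pr_iota; exact: pr_span.
    move=> [u [c [_ uC xE]]].
    (* Coordinates of [x] are those of [iota x], reindexed by [y = v * d]. *)
    exists [seq (y * d^-1)%g | y <- u], (fun y => c (y * d)%g); split.
      move=> _ /mapP[y /uC[Iy [v Kv yE]] ->]; rewrite /= mulgVK; split=> //.
      by rewrite yE mulgK.
    apply: iota_inj; rewrite xE /basis_sum raddf_sum big_map !big_seq.
    apply: eq_bigr => y /uC[Iy [v Kv yE]].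
    by rewrite mulgVK iotaA yE mulgK iotab//; split=> //; rewrite -yE.
  rewrite -(mulgK d w).
  apply: (proj2 basis [seq (y * d)%g | y <- u] (fun y => c (y * d^-1)%g)).
  + by rewrite map_inj_uniq// => y y' /mulIg.
  + by move=> _ /mapP[y /uI[_ Iy] ->].
  + rewrite big_map -[RHS](raddf0 iota) -u0 raddf_sum !big_seq.
    by apply: eq_bigr => y /uI Iy; rewrite mulgK iotaA iotab.
  + exact: map_f.
- move=> w s Iw; have [Kw Iwd] := Iw.
  have Ks : K (val s) := set_mem (valP s).
  have Ksw : generated K (val s * w)%g by apply: generatedM => //; exact: mem_generated.
  have [hSA hSD hWD hWA] := action (gen_incl KS s) Iwd.
  have iotaT : iota (heckeT s *: b' w) = pr (heckeT (gen_incl KS s) *: b (w * d)%g).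
    by rewrite iotaZ hecke_inclT iotab.
  have up : bruhat_lt K w (val s * w)%g -> bruhat_lt S (w * d)%g (val s * (w * d))%g.
    by rewrite mulgA => /(bruhat_lt_mulr cox KS Dd Kw Ksw).
  have DJ : min_left_reps S J (val s * (w * d))%g <-> min_left_reps K L (val s * w)%g.
    by rewrite mulgA; apply: min_left_reps_mulr => //; exact: ID.
  split.
  + move=> [_ lt [_ Isw]]; apply: iota_inj; rewrite iotaT hSA.
      by rewrite iotab//= mulgA pr_basis.
    by split; [exact: KS|exact: up|rewrite /= mulgA].
  + move=> [_ lt]; have ltd : bruhat_lt S (val s * (w * d))%g (w * d)%g.
      by rewrite mulgA; apply/(bruhat_lt_mulr cox KS Dd Ksw Kw).
    have Isw : I_d (val s * w)%g.
      split=> //; rewrite -mulgA; apply: ideal_descent => //; first exact: KS.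
      by apply: (bruhat_lt_length cox SS (Sg _) ltd).
    apply: iota_inj; rewrite iotaT hSD; last by split=> //; exact: KS.
    by rewrite !raddfD/= prZ iotaA !iotab// !mulgA !pr_basis.
  + move=> [_ lt nD]; apply: iota_inj; rewrite iotaT hWD.
      by rewrite !raddfN/= prZ iotaA iotab// pr_basis.
    by split; [exact: KS|exact: up|move=> /DJ].
  move=> [_ lt [Dsw nI]].
  have [|r [r_q Tb]] := hWA.
    split; [exact: KS|exact: up|split; first exact/DJ].
    by move=> Isw; apply: nI; split=> //; rewrite -mulgA.
  exists (fun y => r (y * d)%g); split=> [y [Ky Iy] lty|].
    by apply: r_q => //=; rewrite mulgA; apply/(bruhat_lt_mulr cox KS Dd Ky Ksw).
  have bij := coset_bij Ksw.
  have fin : finite_set [set y | I_d y /\ bruhat_lt K y (val s * w)%g].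
    apply: sub_finite_set (finite_preimage _ (below_finite (val s * w * d)%g)).
      by case: bij => + _ _; move=> /subset_trans; apply; exact: subIsetl.
    by move=> y y' _ _ /mulIg.
  apply: iota_inj; rewrite iotaT Tb !raddfB/= prZ iotaA iotab// pr_basis//.
  congr (_ - _); rewrite !raddf_fsum ?mulgA//.
  set A := [set y | I y /\ bruhat_lt S y _].
  rewrite -(fsbig_widen (A `&` coset) A).
  + rewrite (reindex_fsbig _ _ _ _ bij); apply: eq_fsbigr => y /set_mem[Iy _].
    by rewrite /= prZ pr_basis// iotaA iotab.
  + exact: subIsetl.
  + move=> y [[Iy yx] nAC]; rewrite /= prZ pr_out ?scaler0//.
    by move=> Cy; apply: nAC.
exists (fun x => pi (bar (iota x))); split.
- by move=> x y; apply: iota_inj; rewrite iota_pi raddfD/= !raddfD/= !iota_pi barD prD.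
- by move=> a x; apply: iota_inj; rewrite iota_pi iotaA barZ prZ iotaA iota_pi.
- by move=> x; apply: iota_inj; rewrite !iota_pi pr_bar ?barK ?pr_iota//; exact: span_bar.
- apply: iota_inj; rewrite iota_pi iotab ?mul1g//.
  (* [bar (b d) - b d] involves only [z < d], and those lie in [lower]. *)
  rewrite -[bar _](subrK (b d)) prD.
  rewrite pr_lower ?add0r; first by have := pr_basis I1; rewrite mul1g.
  by apply: basis_span_subset (bar_basis_span Id) => z [Iz]; exact: below_lower.
move=> h x; apply: iota_inj; rewrite iota_pi iotaZ pr_bar; last first.
  by apply: K_closed_hecke => //; exact: coset_lower_K_closed.
rewrite bar_hecke hbar_incl iotaZ iota_pi pr_hecke//; exact: span_bar.
Qed.

End Restriction.
End WGraphModule.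

Theorem theorem8p4 (W : groupType) (S : set W) (I J K : set W) (d : W) :
  coxeter_system S ->
  W_graph_ideal S I J ->
  K `<=` S ->
  (min_right_reps S K `&` I) d ->
  W_graph_ideal K
    [set v | generated K v /\ I (v * d)%g]
    (K `&` [set (d * j * d^-1)%g | j in J]).
Proof.
move=> cox [ideal JS ID [V [b [basis action [bar [barD barZ barK bar1 bar_hecke]]]]]] KS.
move=> [Dd Id]; split.
- split=> [v []//||v w Kv vw [Kw Iw]].
    by exists 1%g; split; [exact: generated1|rewrite mul1g].
  split=> //; have [_ _ down] := ideal; apply: down Iw.
    exact: (coxeter_gen cox (v * d)%g).
  exact: (left_weak_le_mulr cox KS Dd).
- exact: subIsetl.
- by move=> v [Kv /ID]; apply: (proj1 (min_left_reps_mulr cox KS JS Dd (ID _ Id) Kv)).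
exact: (parabolic_module cox ideal basis action barD barZ bar1 bar_hecke KS Dd Id JS barK ID).
Qed.
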